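(* Let $s>0$ and let $p$ be an integer such that $0\le p<s$. Then there is a constant $C>0$ depending only on $s$ and $p$ such that the following holds. Let $E>0$, let $f\in H^s(\mathbb{R})$ with $\|f\|_{H^s(\mathbb{R})}\le E$, let $\delta>0$, and let $f_\delta\in L^2(\mathbb{R})$ with $\|f-f_\delta\|_{L^2(\mathbb{R})}<\delta$. Then $$\|f^{(p)}-D_R^{(p)}f_\delta\|_{L^2(\mathbb{R})}\le C\,E^{p/s}\,\delta^{1-p/s},$$ when $R>0$ is chosen as $R=\left(\frac{E}{\delta}\right)^{1/s}$.
   Context: The Fourier transform is normalized as $\widehat g(\xi)=\frac{1}{\sqrt{2\pi}}\int_{-\infty}^{\infty}g(x)e^{-i\xi x}\,dx$ and extended to an isometry of $L^2(\mathbb{R})$. For $s\in\mathbb{R}$, the Sobolev space $H^s(\mathbb{R})$ has norm $\|g\|_{H^s(\mathbb{R})}=\left(\int_{-\infty}^{\infty}(1+\xi^2)^s|\widehat g(\xi)|^2\,d\xi\right)^{1/2}$. For $g\in H^s(\mathbb{R})$ and an integer $0\le p\le s$, $g^{(p)}$ denotes the $p$th derivative, i.e. the function in $L^2(\mathbb{R})$ whose Fourier transform is $(i\xi)^p\widehat g(\xi)$. A family of measurable functions $m_R:\mathbb{R}\to\mathbb{C}$, $R>0$, is called a family of admissible spectral filters of order $p$ on $H^s$ if $$|\xi|^p|m_R(\xi)|\le C_1R^p\qquad\text{and}\qquad |1-m_R(\xi)|\le C_2\min\left\{1,\left(\frac{|\xi|}{R}\right)^{s-p}\right\}$$ for some constants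 $C_1,C_2>0$ (not depending on $R$ or $\xi$). Throughout, $m_R$ denotes such a family, and the associated regularized differentiation operator $D_R^{(p)}:L^2(\mathbb{R})\to L^2(\mathbb{R})$ of order $p$ on $H^s$ is the Fourier multiplier defined by $\widehat{D_R^{(p)}g}(\xi)=(i\xi)^pm_R(\xi)\widehat g(\xi)$.
   Formalization: The constant C is allowed to depend on the admissibility constants C_1, C_2 of the filter family as well as on s and p (a bound independent of them fails, e.g. for p=0, f=0); it is uniform over all families with these constants. *)

(* Defs.v *)
From mathcomp Require Export all_boot all_order all_algebra.
From mathcomp Require Export all_classical all_reals all_analysis.
From mathcomp Require Export complex.

Export Order.TTheory GRing.Theory Num.Theory.
Export numFieldNormedType.Exports.

Set Implicit Arguments.
Unset Strict Implicit.
Unset Printing Implicit Defensive.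

Local Open Scope classical_set_scope.
Local Open Scope ring_scope.
Local Open Scope complex_scope.

Local Notation mu := lebesgue_measure.

Definition cnorm (R : realType) (z : R[i]) : R := ComplexField.Normc.normc z.

Definition cmeasurable (R : realType) (g : R -> R[i]) : Prop :=
  measurable_fun [set: R] (fun x => complex.Re (g x)) /\
  measurable_fun [set: R] (fun x => complex.Im (g x)).

(* Only used for g with integrable norm, since Rintegral is total. *)
Definition cintegral (R : realType) (g : R -> R[i]) : R[i] :=
  (\int[mu]_(x in [set: R]) complex.Re (g x)) +i*
  (\int[mu]_(x in [set: R]) complex.Im (g x)).

Definition Lpnorm (R : realType) (q : R) (g : R -> R[i]) : \bar R :=
  Lnorm (@lebesgue_measure R) q%:E (fun x => (cnorm (g x))%:E).

Definition Lpfun (R : realType) (q : R) (g : R -> R[i]) : Prop :=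
  cmeasurable g /\ (Lpnorm q g < +oo)%E.

Definition expi (R : realType) (t : R) : R[i] := cos t +i* sin t.

Definition fourier1 (R : realType) (g : R -> R[i]) (xi : R) : R[i] :=
  (Num.sqrt (2 * pi))^-1%:C * cintegral (fun x => g x * expi (- (xi * x))).

(* G represents the image of g under the extension by continuity, from
   L^1 \cap L^2 to L^2, of the integral transform fourier1. *)
Definition is_fourier (R : realType) (g G : R -> R[i]) : Prop :=
  [/\ Lpfun 2 g, Lpfun 2 G &
   exists u : nat -> R -> R[i],
     [/\ forall n, Lpfun 1 (u n) /\ Lpfun 2 (u n),
         (fun n => Lpnorm 2 (u n \- g)) @ \oo --> 0%E &
         (fun n => Lpnorm 2 (fourier1 (u n) \- G)) @ \oo --> 0%E]].

(* Elements of L^2 are represented by square-integrable functions; the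
   operators below return a chosen representative of a class that exists and is
   unique up to a.e. equality for the arguments they are meant for (any g in L^2
   for fourier; g in L^2 with sigma * fourier g in L^2 for fourier_mult).
   The default value 0 is returned otherwise. *)
Definition fourier (R : realType) (g : R -> R[i]) : R -> R[i] :=
  xget (fun _ => 0) [set G | is_fourier g G].

Definition fourier_mult (R : realType) (sigma g : R -> R[i]) : R -> R[i] :=
  xget (fun _ => 0) [set h | Lpfun 2 h /\
    {ae mu, forall xi, fourier h xi = sigma xi * fourier g xi}].

Definition derivL2 (R : realType) (p : nat) (g : R -> R[i]) : R -> R[i] :=
  fourier_mult (fun xi => (0 +i* xi) ^+ p) g.

Definition Hsnorm (R : realType) (s : R) (g : R -> R[i]) : \bar R :=
  poweR (\int[mu]_(xi in [set: R])
           ((1 + xi ^+ 2) `^ s * cnorm (fourier g xi) ^+ 2)%:E) 2^-1.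

(* Membership in H^s, for s >= 0 only: for s < 0 the space H^s also contains
   distributions that are not in L^2. *)
Definition Hsfun (R : realType) (s : R) (g : R -> R[i]) : Prop :=
  Lpfun 2 g /\ (Hsnorm s g < +oo)%E.

Definition admissible_filters (R : realType) (s : R) (p : nat) (C1 C2 : R)
    (m : R -> R -> R[i]) : Prop :=
  forall r : R, 0 < r ->
    cmeasurable (m r) /\
    forall xi : R,
      `|xi| ^+ p * cnorm (m r xi) <= C1 * r ^+ p /\
      cnorm (1 - m r xi) <= C2 * Num.min 1 ((`|xi| / r) `^ (s - p%:R)).

Definition regdiff (R : realType) (p : nat) (m : R -> R -> R[i]) (r : R)
    (g : R -> R[i]) : R -> R[i] :=
  fourier_mult (fun xi => (0 +i* xi) ^+ p * m r xi) g.

(* Main.v *)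
Require Import Defs.
From mathcomp Require Import measurable_realfun ring lra.

(** The error is estimated on the Fourier side, where both operators are
multiplications. Write F for the Fourier transform, sigma x = (i x) ^ p and
r = (E / delta) ^ (1 / s); then

  sigma F f - sigma m_r F fdelta
    = sigma (1 - m_r) F f + sigma m_r F (f - fdelta).

Since |x|^p |1 - m_r x| <= C2 |x|^p (|x| / r)^(s - p) = C2 r^(p - s) |x|^s, the
first term has norm at most C2 r^(p - s) E; the second one has norm at most
C1 r^p delta. The choice of r makes r^(p - s) E and r^p delta both equal to
E^(p / s) delta^(1 - p / s). This is the content of [monomial_bounds],
[fourier_multB_le] and [rate_identities].

What carries the argument is Plancherel's theorem: F is a surjective isometry of
L2. The isometry brings the estimate back to the functions themselves, and
surjectivity is what makes a Fourier multiplier denote a function at all.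

The isometry is first obtained on step functions. The real part of the product of
the transform of ]a, b] with the conjugate transform of ]a', b'] is a combination
of functions (1 - cos (t x)) / x^2; by scaling, the integral of such a function is
proportional to |t|; and the resulting combination of the four distances between
end points is twice the length of the intersection of the two intervals
([spectral_dot_indic]). Hence F preserves the inner product of step functions up
to a universal constant. Step functions are dense in the intersection of L1 and
L2, for both norms at once ([step_dense], a pi-lambda argument followed by simple
functions). Fatou's lemma then gives one inequality on that intersection, and the
deficit, being a nonnegative quadratic form that vanishes on step functions, is
zero by the parallelogram identity ([plancherel_const]). Evaluating both sides on
exp (- x) on the half line, whose transform is 1 / (1 + i x) before normalization,
gives the constant
([fourier_constE]). For complex functions the cross terms are odd in the
frequency and integrate to zero ([plancherel_complex]).

Completeness of L2 extends F to L2. Fubini's theorem says that F is symmetric for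
the bilinear pairing, so its adjoint is the conjugate of F by complex conjugation;
the isometry reads F* F = 1, and conjugating this identity gives F F* = 1, which is
surjectivity ([fourier_rel_surj]). *)

Set Implicit Arguments.
Unset Strict Implicit.
Unset Printing Implicit Defensive.

Local Open Scope classical_set_scope.
Local Open Scope ring_scope.
Local Open Scope complex_scope.

(** * Integrals of real functions on the line, and convergence theorems *)

Section integrals.
Context {R : realType}.
Local Notation mu := (@lebesgue_measure R).
Implicit Types (u v w : R -> R) (c : R) (P Q : R -> Prop).

(** Almost everywhere reasoning for the Lebesgue measure: this lemma and the next two
fix the measurable structure of the line, which inference does not find. *)
Lemma aeS P Q : (forall x, P x -> Q x) -> {ae mu, forall x, P x} -> {ae mu, forall x, Q x}.
Proof. by move=> PQ; apply: negligibleS => x /=; apply: contra_not; exact: PQ. Qed.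

Lemma aeI P Q : {ae mu, forall x, P x} -> {ae mu, forall x, Q x} -> {ae mu, forall x, P x /\ Q x}.
Proof.
move=> hP hQ; have := negligibleU hP hQ; apply: negligibleS => x /=.
by move=> /not_andP.
Qed.

Lemma aeT P : (forall x, P x) -> {ae mu, forall x, P x}.
Proof. by move=> hP; exists set0; split => // x /(_ (hP x)). Qed.

Lemma normM_le_sqrD (a b : R) : `|a * b| <= a ^+ 2 + b ^+ 2.
Proof.
have := sqr_ge0 (a + b); have := sqr_ge0 (a - b); have := sqr_ge0 a.
have := sqr_ge0 b; rewrite ler_norml => ? ? ? ?; apply/andP; split; lra.
Qed.

Lemma sqrD_le (a b : R) : (a + b) ^+ 2 <= 2 * (a ^+ 2 + b ^+ 2).
Proof. by have := sqr_ge0 (a - b); lra. Qed.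

Definition L1 u := mu.-integrable setT (EFin \o u).
Definition L2 u := measurable_fun setT u /\ L1 (fun x => u x ^+ 2).
Definition intR u : R := \int[mu]_x u x.

Lemma measurable_L1 u : L1 u -> measurable_fun setT u.
Proof. by move=> /integrableP[/measurable_EFinP]. Qed.

Lemma L1D u v : L1 u -> L1 v -> L1 (fun x => u x + v x).
Proof. by move=> hu hv; apply: (integrableD measurableT hu hv). Qed.

Lemma L1Z c u : L1 u -> L1 (fun x => c * u x).
Proof. by move=> hu; apply: (integrableZl measurableT c hu). Qed.

Lemma L1N u : L1 u -> L1 (fun x => - u x).
Proof. by move=> hu; apply: (integrableN hu). Qed.

Lemma L1B u v : L1 u -> L1 v -> L1 (fun x => u x - v x).
Proof. by move=> hu hv; apply: L1D => //; exact: L1N. Qed.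

Lemma L1_norm u : L1 u -> L1 (fun x => `|u x|).
Proof. by move=> hu; apply: (integrable_norm hu). Qed.

Lemma L1_0 : L1 (fun=> 0).
Proof. exact: integrable0. Qed.

Lemma L1_le u v : measurable_fun setT u -> L1 v -> (forall x, `|u x| <= v x) -> L1 u.
Proof.
move=> mu_ hv uv; apply: (le_integrable measurableT _ _ hv).
  exact/measurable_EFinP.
by move=> x _ /=; rewrite lee_fin (le_trans (uv x)) ?ler_norm.
Qed.

Lemma L1_ext u v : u =1 v -> L1 u -> L1 v.
Proof. by move=> /funext ->. Qed.

Lemma eq_intR u v : u =1 v -> intR u = intR v.
Proof. by move=> /funext ->. Qed.

Lemma intRD u v : L1 u -> L1 v -> intR (fun x => u x + v x) = intR u + intR v.
Proof. by move=> hu hv; rewrite /intR RintegralD. Qed.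

Lemma intRB u v : L1 u -> L1 v -> intR (fun x => u x - v x) = intR u - intR v.
Proof. by move=> hu hv; rewrite /intR RintegralB. Qed.

Lemma intRZ c u : L1 u -> intR (fun x => c * u x) = c * intR u.
Proof. by move=> hu; rewrite /intR RintegralZl. Qed.

Lemma intRN u : L1 u -> intR (fun x => - u x) = - intR u.
Proof.
move=> hu; rewrite -mulN1r -intRZ //; apply: eq_intR => x; by rewrite mulN1r.
Qed.

Lemma intR0 : intR (fun=> 0) = 0.
Proof. by rewrite /intR /Rintegral integral0. Qed.

Lemma intR_ge0 u : (forall x, 0 <= u x) -> 0 <= intR u.
Proof. by move=> u0; apply: Rintegral_ge0. Qed.

Lemma le_intR u v : L1 u -> L1 v -> (forall x, u x <= v x) -> intR u <= intR v.
Proof. by move=> hu hv uv; apply: le_Rintegral. Qed.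

Lemma le_norm_intR u : L1 u -> `|intR u| <= intR (fun x => `|u x|).
Proof. by move=> hu; apply: le_normr_Rintegral. Qed.

Lemma intRE u : L1 u -> ((intR u)%:E = \int[mu]_x (u x)%:E)%E.
Proof. by move=> hu; rewrite fineK // integrable_fin_num. Qed.

Lemma L1_nonneg u : measurable_fun setT u -> (forall x, 0 <= u x) ->
  (\int[mu]_x (u x)%:E < +oo)%E -> L1 u.
Proof.
move=> mu_ u0 h; apply/integrableP; split; first exact/measurable_EFinP.
by under eq_integral do rewrite /= ger0_norm //.
Qed.

(** Transfers both integrability and the value of the integral; this is how pointwise
formulas that fail on a null set, such as at the frequency 0, are used. *)
Lemma L1_ae_eq u v : L1 u -> measurable_fun setT v ->
  {ae mu, forall x, u x = v x} -> L1 v /\ intR u = intR v.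
Proof.
move=> hu mv uv.
have e : (\int[mu]_x `|(u x)%:E| = \int[mu]_x `|(v x)%:E|)%E.
  apply: ae_eq_integral => //.
  - apply/measurableT_comp => //; apply/measurable_EFinP; exact: measurable_L1.
  - by apply/measurableT_comp => //; apply/measurable_EFinP.
  - by apply: aeS uv => x -> _.
split.
  apply/integrableP; split; first exact/measurable_EFinP.
  by rewrite -e; move/integrableP : hu => [].
congr fine; apply: ae_eq_integral => //.
- by apply/measurable_EFinP; exact: measurable_L1.
- exact/measurable_EFinP.
- by apply: aeS uv => x -> _.
Qed.

Lemma intR_eq0_ae u : L1 u -> (forall x, 0 <= u x) -> intR u = 0 ->
  {ae mu, forall x, u x = 0}.
Proof.
move=> hu u0 Iu.
have := intRE hu; rewrite Iu => /esym h.
have mEu : measurable_fun setT (EFin \o u).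
  by apply/measurable_EFinP; exact: measurable_L1.
have /(ae_eq_integral_abs mu measurableT mEu) : (\int[mu]_x `|(EFin \o u) x| = 0)%E.
  by rewrite -[RHS]h; apply: eq_integral => x _; rewrite /= ger0_norm.
by apply: aeS => x /(_ I) [].
Qed.

Lemma measurable_L2 u : L2 u -> measurable_fun setT u. Proof. by case. Qed.
Lemma L2_sq u : L2 u -> L1 (fun x => u x ^+ 2). Proof. by case. Qed.

Lemma L2_le u w : measurable_fun setT u -> L1 w -> (forall x, u x ^+ 2 <= w x) ->
  L2 u.
Proof.
move=> mu_ hw h; split => //; apply: (L1_le _ hw).
  exact: measurable_funX.
by move=> x; rewrite ger0_norm ?sqr_ge0.
Qed.

Lemma L2M u v : L2 u -> L2 v -> L1 (fun x => u x * v x).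
Proof.
move=> [mu_ hu] [mv hv]; apply: (L1_le _ (L1D hu hv)).
  exact: measurable_funM.
by move=> x; exact: normM_le_sqrD.
Qed.

Lemma L2D u v : L2 u -> L2 v -> L2 (fun x => u x + v x).
Proof.
move=> hu hv.
apply: (L2_le _ (L1Z 2 (L1D (L2_sq hu) (L2_sq hv)))).
  by apply: measurable_funD; apply: measurable_L2.
by move=> x; exact: sqrD_le.
Qed.

Lemma L2Z c u : L2 u -> L2 (fun x => c * u x).
Proof.
move=> hu.
apply: (L2_le _ (L1Z (c ^+ 2) (L2_sq hu))).
  by apply: measurable_funM => //; apply: measurable_L2.
by move=> x; rewrite exprMn.
Qed.

Lemma L2N u : L2 u -> L2 (fun x => - u x).
Proof.
move=> [mu_ hu]; split; first exact: measurableT_comp.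
by apply: L1_ext hu => x; rewrite sqrrN.
Qed.

Lemma L2B u v : L2 u -> L2 v -> L2 (fun x => u x - v x).
Proof. by move=> hu hv; apply: L2D => //; exact: L2N. Qed.

Lemma L2_0 : L2 (fun=> 0).
Proof. by split => //; apply: L1_ext L1_0 => x; rewrite expr0n. Qed.

Lemma L2_ext u v : u =1 v -> L2 u -> L2 v.
Proof. by move=> /funext ->. Qed.

Lemma dominated_cvg_intR (f_ : nat -> R -> R) (f g : R -> R) :
  (forall n, measurable_fun setT (f_ n)) -> L1 g ->
  (forall n x, `|f_ n x| <= g x) ->
  (forall x, f_ n x @[n --> \oo] --> f x) ->
  L1 f /\ (intR (f_ n) @[n --> \oo] --> intR f).
Proof.
move=> mf hg fg ff.
have mf_ n : measurable_fun setT (EFin \o f_ n) by apply/measurable_EFinP.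
have mF : measurable_fun setT (EFin \o f).
  by apply/measurable_EFinP; exact: (measurable_fun_cvg _ (fun x _ => ff x)).
have [] := @dominated_convergence _ _ _ mu setT measurableT
  (fun n => EFin \o f_ n) (EFin \o f) (EFin \o g) mf_ mF _ hg _.
- apply: aeT => x _; apply: cvg_EFin; [exact: nearW|exact: ff].
- by apply: aeT => x n _; rewrite lee_fin.
move=> h _ cv; split => //.
by apply: fine_cvg; rewrite intRE.
Qed.

(** Kept with an extended real integrand because the lower limit may be infinite; the
completeness proof uses precisely that it is finite almost everywhere. *)
Lemma fatou_limn_einf (f_ : nat -> R -> R) (M : R) :
  (forall n, L1 (f_ n)) -> (forall n x, 0 <= f_ n x) -> (forall n, intR (f_ n) <= M) ->
  (\int[mu]_x limn_einf (fun n => (f_ n x)%:E) <= M%:E)%E.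
Proof.
move=> hf f0 fM.
have mf_ n : measurable_fun setT (EFin \o f_ n).
  by apply/measurable_EFinP; exact: (measurable_L1 (hf n)).
apply: (le_trans (fatou mu measurableT mf_ _)).
  by move=> n x _; rewrite lee_fin.
rewrite limn_einf_lim; apply: lime_le; first exact: is_cvg_einfs.
apply: nearW => n; apply: (@le_trans _ _ (\int[mu]_x (f_ n x)%:E)%E).
  by apply: ereal_inf_lbound; exists n => //=.
by rewrite -intRE // lee_fin.
Qed.

Lemma measurable_limn_einf (f_ : nat -> R -> R) :
  (forall n, measurable_fun setT (f_ n)) ->
  measurable_fun setT (fun x => limn_einf (fun n => (f_ n x)%:E)).
Proof.
move=> mf; rewrite /limn_einf; apply: measurableT_comp => //.
apply: measurable_fun_limn_esup => n; apply: measurableT_comp => //.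
by apply/measurable_EFinP; exact: mf.
Qed.

(** The form of Fatou's lemma used below: a uniform bound on the integrals passes to
the almost everywhere limit, together with integrability. *)
Lemma fatou_intR (f_ : nat -> R -> R) (f : R -> R) (M : R) :
  (forall n, L1 (f_ n)) -> (forall n x, 0 <= f_ n x) -> (forall n, intR (f_ n) <= M) ->
  measurable_fun setT f -> {ae mu, forall x, f_ n x @[n --> \oo] --> f x} ->
  (forall x, 0 <= f x) ->
  L1 f /\ intR f <= M.
Proof.
move=> hf f0 fM mf ff f_ge0.
have h : (\int[mu]_x (f x)%:E <= M%:E)%E.
  apply: le_trans (fatou_limn_einf hf f0 fM); rewrite le_eqVlt; apply/orP; left; apply/eqP.
  apply: ae_eq_integral => //; first exact/measurable_EFinP.
    by apply: measurable_limn_einf => n; exact: measurable_L1.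
  apply: aeS ff => x fx _.
  have cv : (f_ n x)%:E @[n --> \oo] --> (f x)%:E.
    by apply: cvg_EFin => //; exact: nearW.
  by rewrite is_cvg_limn_einfE; [apply/esym/cvg_lim|apply: cvgP cv].
have hL : L1 f by apply: L1_nonneg => //; exact: le_lt_trans h (ltry _).
by split => //; rewrite -lee_fin intRE.
Qed.

End integrals.

(** * Integral transforms with a bounded kernel *)

Section kernel_transform.
Context {R : realType}.
Local Notation mu := (@lebesgue_measure R).
Implicit Types (u v w phi : R -> R) (c : R).

(** With the kernels cos and sin this is the real part and, up to sign, the imaginary
part of the Fourier transform of a real function. A common definition lets linearity,
continuity and symmetry be proved once. *)
Definition kernel_transform phi u (xi : R) : R := intR (fun x => u x * phi (xi * x)).
Local Notation T := kernel_transform.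

Definition bounded_kernel phi := continuous phi /\ forall x, `|phi x| <= 1.

Lemma bounded_kernel_cos : bounded_kernel cos.
Proof. by split; [exact: continuous_cos|exact: cos_max]. Qed.

Lemma bounded_kernel_sin : bounded_kernel sin.
Proof. by split; [exact: continuous_sin|exact: sin_max]. Qed.

Context (phi : R -> R) (hphi : bounded_kernel phi).

Lemma continuous_kernel xi : continuous (fun x : R => phi (xi * x)).
Proof.
move=> x; apply: (@continuous_comp _ _ _ (fun x : R => xi * x) phi).
  by apply: cvgM; [exact: cvg_cst|exact: cvg_id].
exact: hphi.1.
Qed.

Lemma L1_kernel u xi : L1 u -> L1 (fun x => u x * phi (xi * x)).
Proof.
move=> hu; apply: (L1_le _ (L1_norm hu)).
  apply: measurable_funM; first exact: measurable_L1.
  by apply: continuous_measurable_fun; exact: continuous_kernel.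
by move=> x; rewrite normrM ler_piMr // hphi.2.
Qed.

Lemma kernel_transform_le u xi : L1 u -> `|T phi u xi| <= intR (fun x => `|u x|).
Proof.
move=> hu; apply: (le_trans (le_norm_intR (L1_kernel xi hu))).
apply: le_intR; [exact: (L1_norm (L1_kernel _ hu))|exact: L1_norm|].
by move=> x; rewrite normrM ler_piMr // hphi.2.
Qed.

Lemma kernel_transformD u v xi : L1 u -> L1 v -> T phi (fun x => u x + v x) xi = T phi u xi + T phi v xi.
Proof.
move=> hu hv; rewrite /T -intRD; [|exact: L1_kernel..].
by apply: eq_intR => x; rewrite mulrDl.
Qed.

Lemma kernel_transformZ c u xi : L1 u -> T phi (fun x => c * u x) xi = c * T phi u xi.
Proof.
move=> hu; rewrite /T -intRZ; [|exact: L1_kernel].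
by apply: eq_intR => x; rewrite mulrA.
Qed.

Lemma kernel_transformB u v xi : L1 u -> L1 v -> T phi (fun x => u x - v x) xi = T phi u xi - T phi v xi.
Proof.
move=> hu hv; rewrite /T -intRB; [|exact: L1_kernel..].
by apply: eq_intR => x; rewrite mulrBl.
Qed.

Lemma continuous_kernel_transform u : L1 u -> continuous (T phi u).
Proof.
move=> hu a.
have := @continuity_under_integral R _ _ mu (fun xi x => u x * phi (xi * x)) setT
  measurableT (a - 1) (a + 1) _ _ (fun x => `|u x|) _ _ a.
apply.
- by move=> x _; exact: L1_kernel.
- apply: aeT => y _ x _; apply: cvgM; first exact: cvg_cst.
  under eq_fun do rewrite mulrC; rewrite [x * y]mulrC; exact: continuous_kernel.
- exact: L1_norm.
- move=> x _; apply: aeT => y _.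
  by rewrite normrM ler_piMr // hphi.2.
- by rewrite inE /= in_itv /=; apply/andP; split; lra.
Qed.

Lemma measurable_kernel_transform u : L1 u -> measurable_fun setT (T phi u).
Proof. by move=> hu; apply: continuous_measurable_fun; exact: continuous_kernel_transform. Qed.

Lemma L1_kernel_transformM u v : L1 u -> L1 v -> L1 (fun x => T phi u x * v x).
Proof.
move=> hu hv; apply: (L1_le _ (L1Z (intR (fun x => `|u x|)) (L1_norm hv))).
  by apply: measurable_funM; [exact: measurable_kernel_transform|exact: measurable_L1].
by move=> x; rewrite normrM ler_wpM2r // kernel_transform_le.
Qed.

(** Fubini's theorem for u x * v y * phi (x * y), which is dominated by |u x| * |v
y|. *)
Lemma kernel_transform_sym u v : L1 u -> L1 v ->
  intR (fun x => T phi u x * v x) = intR (fun x => u x * T phi v x).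
Proof.
move=> hu hv.
pose f (z : R * R) : \bar R := (u z.1 * v z.2 * phi (z.1 * z.2))%:E.
have mf : measurable_fun setT f.
  apply/measurable_EFinP; apply: measurable_funM; first apply: measurable_funM.
  - by apply: (measurableT_comp (measurable_L1 hu)); exact: measurable_fst.
  - by apply: (measurableT_comp (measurable_L1 hv)); exact: measurable_snd.
  - apply: (measurableT_comp (continuous_measurable_fun hphi.1)).
    by apply: measurable_funM; [exact: measurable_fst|exact: measurable_snd].
have intf : (mu \x mu)%E.-integrable setT f.
  have := @integrable12ltyP _ _ _ _ R mu mu f mf => -> .
  apply: (@le_lt_trans _ _ (\int[mu]_x (`|u x| * intR (fun y => `|v y|))%:E)%E).
    apply: ge0_le_integral => //.
    - by move=> x _; exact: integral_ge0.
    - apply: (@measurable_fun_fubini_tonelli_F _ _ _ _ R mu (abse \o f)) => //.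
      + exact: measurableT_comp.
      + by move=> z; apply: abse_ge0.
    - by apply/measurable_EFinP; apply: measurable_funM => //;
        exact: (measurable_L1 (L1_norm hu)).
    - move=> x _; rewrite -intRZ ?intRE; [|exact: (L1Z _ (L1_norm hv))|exact: L1_norm].
      apply: ge0_le_integral => //.
      + apply: measurableT_comp => //.
        exact: (measurableT_comp mf (pair1_measurable x)).
      + by apply/measurable_EFinP; apply: measurable_funM => //;
          exact: (measurable_L1 (L1_norm hv)).
      + by move=> y _; rewrite lee_fin !normrM ler_piMr ?hphi.2.
  have h : L1 (fun x => `|u x| * intR (fun y => `|v y|)).
    apply: (@L1_ext _ (fun x => intR (fun y => `|v y|) * `|u x|)).
      by move=> x; rewrite mulrC.
    exact: (L1Z _ (L1_norm hu)).
  by rewrite -(intRE h) ltry.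
have := Fubini intf; rewrite /f /= => e.
transitivity (fine (\int[mu]_y \int[mu]_x f (x, y))%E).
  congr fine; apply: eq_integral => y _; rewrite mulrC -intRZ ?intRE; last 2 first.
  - exact: (L1Z _ (L1_kernel _ hu)).
  - exact: L1_kernel.
  by apply: eq_integral => x _; congr EFin => /=; rewrite (mulrC y x); ring.
rewrite -e; congr fine; apply: eq_integral => x _.
rewrite -intRZ ?intRE; [|exact: (L1Z _ (L1_kernel _ hv))|exact: L1_kernel].
by apply: eq_integral => y _; congr EFin; rewrite mulrA.
Qed.

End kernel_transform.

(** * Dilations and reflections; the integral of (1 - cos (t x)) / x ^+ 2 *)

Section changes_of_variable.
Context {R : realType}.
Local Notation mu := (@lebesgue_measure R).
Implicit Types (u v w : R -> R) (c : R).

Lemma measurable_dilation c : measurable_fun setT (fun x : R => c * x).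
Proof. exact: measurable_funM. Qed.

Definition dilation (t : R) : measurableTypeR R -> measurableTypeR R := fun x => t * x.

(** The multiple by t of the image of the Lebesgue measure under the dilation by t;
it is again the Lebesgue measure, which is the change of variables formula for
dilations. *)
Definition dilated_measure (t : {nonneg R}) : {measure set (measurableTypeR R) -> \bar R} :=
  (* The measure structure of an image depends on a proof of measurability. *)
  mscale t (measure_function_pushforward__canonical__measure_function_Measure mu
    (measurable_dilation t%:num : measurable_fun setT (dilation t%:num))).

Lemma lebesgue_measureZ (t : {nonneg R}) (A : set R) : 0 < t%:num -> measurable A ->
  mu A = dilated_measure t A.
Proof.
move=> t0 mA; apply: lebesgue_measure_unique => //= _ [[a b]] _ <-.
rewrite /dilated_measure /= /mscale.
change (mu `]a, b] = (t%:num%:E * mu (dilation t%:num @^-1` `]a, b]))%E)%classic.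
have -> : (dilation t%:num @^-1` `]a, b])%classic =
    (`]a / t%:num, b / t%:num])%classic.
  apply/seteqP; split => x /=; rewrite !in_itv /= /dilation;
    by rewrite ltr_pdivrMr // ler_pdivlMr // (mulrC x).
rewrite /= !lebesgue_measure_itv/= !lte_fin ltr_pM2r ?invr_gt0 //.
case: ifPn => _; last by rewrite mule0.
rewrite -!EFinD -EFinM; congr EFin; field; exact: lt0r_neq0.
Qed.

Lemma ge0_integral_dilation (t : R) (f : R -> R) : 0 < t ->
  measurable_fun setT f -> (forall x, 0 <= f x) ->
  (\int[mu]_x (f x)%:E = t%:E * \int[mu]_x (f (t * x))%:E)%E.
Proof.
move=> t0 mf f0.
pose tn : {nonneg R} := NngNum (ltW t0).
have mF : measurable_fun setT (EFin \o f) by apply/measurable_EFinP.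
transitivity (\int[dilated_measure tn]_x (f x)%:E)%E.
  apply: eq_measure_integral => A mA _; exact: (@lebesgue_measureZ tn).
rewrite /dilated_measure ge0_integral_mscale //=; last by move=> x _; rewrite lee_fin.
congr (_ * _)%E.
have mt : measurable_fun setT (dilation t) by exact: measurable_dilation.
rewrite (ge0_integral_pushforward mt mu measurableT mF) //.
by move=> x _; rewrite lee_fin.
Qed.

(** The nonnegative case is invariance of the measure. A general u is the difference
of the nonnegative functions |u| + u and |u|. *)
Lemma intR_reflection u : L1 u -> L1 (fun x => u (- x)) /\ intR (fun x => u (- x)) = intR u.
Proof.
have gen (f : R -> R) : measurable_fun setT f -> (forall x, 0 <= f x) ->
  (\int[mu]_x (f x)%:E = \int[mu]_x (f (- x))%:E)%E.
  move=> mf f0.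
  transitivity (\int[pushforward mu (-%R : _ -> measurableTypeR R)]_x (f x)%:E)%E.
    by apply: eq_measure_integral => A mA _; apply/esym; exact: lebesgue_measureN.
  have mF : measurable_fun setT (EFin \o f) by apply/measurable_EFinP.
  have mN : measurable_fun setT (-%R : measurableTypeR R -> measurableTypeR R).
    exact: oppr_measurable.
  rewrite (ge0_integral_pushforward mN mu measurableT mF) //.
  by move=> x _; rewrite lee_fin.
move=> hu; have mr : measurable_fun setT (fun x : R => u (- x)).
  by apply: (measurableT_comp (measurable_L1 hu)); exact: oppr_measurable.
have hr : L1 (fun x => u (- x)).
  move/integrableP : (hu) => [_ h].
  apply/integrableP; split; first exact/measurable_EFinP.
  apply: le_lt_trans h.
  by rewrite /= (gen (fun x => `|u x|)) //; exact: (measurable_L1 (L1_norm hu)).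
split => //.
have : intR (fun x => `|u x|) = intR (fun x => `|u (- x)|).
  by congr fine; apply: (gen (fun x => `|u x|)) => //; exact: (measurable_L1 (L1_norm hu)).
have : intR (fun x => `|u x| + u x) = intR (fun x => `|u (- x)| + u (- x)).
  congr fine; apply: (gen (fun x => `|u x| + u x)).
    by apply: measurable_funD; [exact: (measurable_L1 (L1_norm hu))|exact: measurable_L1].
  by move=> x; have := ler_norm (- u x); rewrite normrN; lra.
rewrite !intRD //; [|exact: L1_norm..].
lra.
Qed.

Lemma intR_odd u : L1 u -> (forall x, u (- x) = - u x) -> intR u = 0.
Proof.
move=> hu odd_u; have [_ h] := intR_reflection hu.
have : intR u = - intR u by rewrite -{1}h -intRN //; apply: eq_intR.
lra.
Qed.

End changes_of_variable.

Section one_minus_cos.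
Context {R : realType}.
Local Notation mu := (@lebesgue_measure R).

Lemma intR_oneDsqr : L1 (fun x : R => (1 + x ^+ 2)^-1) /\
  intR (fun x : R => (1 + x ^+ 2)^-1) = pi.
Proof.
have m1 : measurable_fun setT (fun x : R => (1 + x ^+ 2)^-1).
  by apply: continuous_measurable_fun; exact: continuous_oneDsqrV.
have p0 (x : R) : 0 <= (1 + x ^+ 2)^-1 by rewrite invr_ge0 addr_ge0 ?sqr_ge0.
have mE : measurable_fun setT (fun x : R => ((1 + x ^+ 2)^-1)%:E).
  exact/measurable_EFinP.
have h : (\int[mu]_x ((1 + x ^+ 2)^-1)%:E = pi%:E)%E.
  have hr : (\int[mu]_(x in `[0%R, +oo[) ((1 + x ^+ 2)^-1)%:E = (pi / 2)%:E)%E.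
    exact: integral0y_oneDsqr.
  have -> : [set: R] = `]-oo, 0%R] `|` `]0%R, +oo[.
    apply/seteqP; split => x //= _; rewrite !in_itv /= andbT.
    by have [|] := leP x 0; [left|right].
  rewrite ge0_integral_setU //=.
  - rewrite integral_itv_obnd_cbnd; last exact: measurable_funS mE.
    rewrite hr.
    have := @ge0_integration_by_substitution0 R
      (fun x : R => ((1 + x ^+ 2)^-1)%:E) mE.
    rewrite hr => e; under eq_integral do rewrite -sqrrN.
    by rewrite -e // -EFinD -splitr.
  - exact: measurable_funS mE.
  - by move=> x _; rewrite lee_fin.
  - by rewrite disj_set2E; apply/eqP; rewrite -subset0 => x /=;
      rewrite !in_itv /= andbT => -[x0 /(le_lt_trans x0)]; rewrite ltxx.
split; last by rewrite /intR /Rintegral h.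
by apply: L1_nonneg => //; rewrite h ltry.
Qed.

Lemma sin_sqr_le (z : R) : sin z ^+ 2 <= z ^+ 2.
Proof.
wlog z0 : z / 0 <= z.
  move=> h; have [|/ltW z0] := leP 0 z; first exact: h.
  by rewrite -[leLHS]sqrrN -[leRHS]sqrrN -sinN; apply: h; rewrite oppr_ge0.
move: z0; rewrite le_eqVlt => /predU1P[<-|z0]; first by rewrite sin0.
have cs : {within `[0, z], continuous (@sin R)}.
  by apply: continuous_subspaceT; exact: continuous_sin.
have [c _] := MVT z0 (fun x _ => is_derive_sin x) cs.
rewrite sin0 !subr0 => ->.
by rewrite exprMn ler_piMl ?sqr_ge0 // -real_normK ?num_real // expr_le1 // cos_max.
Qed.

Lemma one_minus_cos_ge0 (y : R) : 0 <= 1 - cos y.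
Proof. by rewrite subr_ge0 cos_le1. Qed.

Lemma one_minus_cos_le (y : R) : 1 - cos y <= y ^+ 2 / 2.
Proof.
set z := y / 2.
have yz : y = z *+ 2 by rewrite /z -mulr_natr divfK.
have -> : 1 - cos y = 2 * sin z ^+ 2.
  rewrite yz cos_mulr2n sin2cos2; move: (cos z ^+ 2) => c; ring.
have -> : y ^+ 2 / 2 = 2 * z ^+ 2 by rewrite /z; field.
by rewrite ler_pM2l // sin_sqr_le.
Qed.

(** At x = 0 the value is 0 because of the convention for division by zero, instead
of the limit t ^ 2 / 2; a single point does not matter for integrals. *)
Definition one_minus_cos_quot (t x : R) := (1 - cos (t * x)) / x ^+ 2.
Local Notation q := one_minus_cos_quot.

Lemma one_minus_cos_quot_ge0 t x : 0 <= q t x.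
Proof. by rewrite divr_ge0 ?sqr_ge0 // one_minus_cos_ge0. Qed.

Lemma measurable_one_minus_cos_quot t : measurable_fun setT (q t).
Proof.
apply: measurable_funM.
  apply: measurable_funB => //; apply: continuous_measurable_fun.
  exact: (continuous_kernel bounded_kernel_cos).
have -> : (fun x : R => (x ^+ 2)^-1) = (fun x => (x ^+ 2) `^ (-1)).
  by apply/funext => x; rewrite powR_inv1 ?sqr_ge0.
apply: (measurableT_comp (measurable_powR _)).
exact: exprn_measurable.
Qed.

(** Near 0 the quotient is at most t ^ 2 / 2, far away at most 2 / x ^ 2; both bounds
are captured by a multiple of 1 / (1 + x ^ 2). *)
Lemma L1_one_minus_cos_quot t : L1 (q t).
Proof.
apply: (L1_le (measurable_one_minus_cos_quot t) (L1Z (2 + t ^+ 2 / 2) intR_oneDsqr.1)) => x.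
rewrite ger0_norm ?one_minus_cos_quot_ge0 // ler_pdivlMr ?ltr_pwDl ?sqr_ge0 //.
rewrite /q; have [->|x0] := eqVneq x 0.
  rewrite expr0n /= invr0 mulr0 mul0r; have := sqr_ge0 t; lra.
rewrite mulrDr mulr1 divfK ?expf_neq0 // addrC lerD //.
  have := cos_geN1 (t * x); lra.
rewrite ler_pdivrMr ?exprn_even_gt0 //.
have := one_minus_cos_le (t * x); rewrite exprMn; lra.
Qed.

(** The substitution x -> |t| x. The constant of proportionality, the integral for t
= 1, stays undetermined here and is found later by testing Plancherel's identity on
one function. *)
Lemma intR_one_minus_cos_quot t : intR (q t) = intR (q 1) * `|t|.
Proof.
have [->|t0] := eqVneq t 0.
  rewrite normr0 mulr0 -[RHS]intR0; apply: eq_intR => x.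
  by rewrite /q mul0r cos0 subrr mul0r.
have -> : intR (q t) = intR (q `|t|).
  apply: eq_intR => x; rewrite /q; congr ((1 - _) / _).
  by case: (ger0P t) => _ //; rewrite mulNr cosN.
have {}t0 : 0 < `|t| by rewrite normr_gt0.
have e : (fun x => `|t| ^- 2 * q `|t| x) =1 (fun x => q 1 (`|t| * x)).
  by move=> x; rewrite /q mul1r [in RHS]exprMn [in RHS]invfM mulrCA.
have hq : L1 (fun x => q 1 (`|t| * x)) by apply: (L1_ext e); apply: L1Z; exact: L1_one_minus_cos_quot.
have -> : intR (q 1) = `|t| * intR (fun x => q 1 (`|t| * x)).
  apply: EFin_inj; rewrite EFinM !intRE //; last exact: L1_one_minus_cos_quot.
  by apply: ge0_integral_dilation => //; [exact: measurable_one_minus_cos_quot|exact: one_minus_cos_quot_ge0].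
rewrite -(eq_intR e) intRZ; last exact: L1_one_minus_cos_quot.
field; exact: lt0r_neq0.
Qed.

End one_minus_cos.

(** * Step functions and the transform of an interval *)

Section step_functions.
Context {R : realType}.
Local Notation mu := (@lebesgue_measure R).
Local Notation q := one_minus_cos_quot.
Local Notation C := (kernel_transform cos).
Local Notation S := (kernel_transform sin).
Implicit Types (u v w : R -> R) (c : R).

(** Left-open, right-closed intervals are stable under intersection and generate the
Borel sets, as the pi-lambda theorem requires. *)
Definition itv_indic (a b : R) : R -> R := \1_`]a, b]%classic.

Inductive step : (R -> R) -> Prop :=
| step0 : step (fun=> 0)
| step_cons c a b u : a <= b -> step u -> step (fun x => c * itv_indic a b x + u x).

Lemma step_indic a b : a <= b -> step (itv_indic a b).
Proof.
move=> ab; have := step_cons 1 ab step0.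
by congr step; apply/funext => x; rewrite mul1r addr0.
Qed.

Lemma stepD u v : step u -> step v -> step (fun x => u x + v x).
Proof.
move=> su sv; elim: su => [|c a b w ab _ ih].
  by move: sv; congr step; apply/funext => x; rewrite add0r.
by have := step_cons c ab ih; congr step; apply/funext => x; rewrite addrA.
Qed.

Lemma stepZ c u : step u -> step (fun x => c * u x).
Proof.
elim => [|d a b w ab _ ih].
  by have := step0; congr step; apply/funext => x; rewrite mulr0.
have := step_cons (c * d) ab ih; congr step; apply/funext => x.
by rewrite mulrDr mulrA.
Qed.

Lemma measurable_itv_indic a b : measurable_fun setT (itv_indic a b).
Proof. exact: measurable_indic. Qed.

Lemma itv_indic_sqr a b x : itv_indic a b x ^+ 2 = itv_indic a b x.
Proof. by rewrite /itv_indic indicE; case: (_ \in _); rewrite ?expr1n ?expr0n. Qed.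

Lemma L1_itv_indic a b : L1 (itv_indic a b).
Proof. exact: integrable_indic_itv. Qed.

Lemma L2_itv_indic a b : L2 (itv_indic a b).
Proof.
split; first exact: measurable_itv_indic.
by apply: L1_ext (L1_itv_indic a b) => x; rewrite itv_indic_sqr.
Qed.

Lemma intR_indic a b : a <= b -> intR (itv_indic a b) = b - a.
Proof.
move=> ab; rewrite /intR /Rintegral integral_indic // setIT.
transitivity (fine (if (a%:E < b%:E)%E then (b%:E - a%:E)%E else 0%E)).
  by congr fine; exact: (@lebesgue_measure_itv R `]a, b]).
rewrite lte_fin; case: ifPn => //.
by rewrite -leNgt => ba; apply/esym/eqP; rewrite subr_eq0 eq_le ba.
Qed.

Lemma itv_indicM a b a' b' x :
  itv_indic a b x * itv_indic a' b' x = itv_indic (Num.max a a') (Num.min b b') x.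
Proof.
rewrite /itv_indic !indicE -natrM mulnb; congr (_%:R); congr nat_of_bool.
apply/idP/idP; rewrite !inE /= !in_itv /= gt_max le_min.
  by move=> /andP[]; rewrite !inE /= !in_itv /= => /andP[-> ->] /andP[-> ->].
move=> /andP[/andP[h1 h2] /andP[h3 h4]].
by apply/andP; split; rewrite inE /= in_itv /= ?h1 ?h2 ?h3 ?h4.
Qed.

(** The length of the intersection of two intervals as a combination of the distances
between their end points: this is the combination that the integrals of (1 - cos (t
x)) / x ^ 2 produce. *)
Lemma intR_indicM a b a' b' : a <= b -> a' <= b' ->
  intR (fun x => itv_indic a b x * itv_indic a' b' x) =
  (`|b - a'| + `|a - b'| - `|b - b'| - `|a - a'|) / 2.
Proof.
move=> ab ab'; rewrite (eq_intR (itv_indicM a b a' b')).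
have empty : Num.min b b' < Num.max a a' ->
    intR (itv_indic (Num.max a a') (Num.min b b')) = 0.
  move=> h; rewrite -[RHS](@intR0 R); apply: eq_intR => x; rewrite /itv_indic indicE.
  rewrite (_ : (x \in _) = false) //; apply/negP; rewrite inE /= in_itv /=.
  by move=> /andP[h1 h2]; have := lt_trans (lt_le_trans h1 h2) h; rewrite ltxx.
have [ba'|a'b] := ltP b a'.
  rewrite empty; last by rewrite lt_max !gt_min ba' orbT.
  rewrite (@ltr0_norm _ (b - a')) ?(@ler0_norm _ (a - b')) ?(@ler0_norm _ (b - b'))
    ?(@ler0_norm _ (a - a')); by lra.
have [b'a|ab''] := ltP b' a.
  rewrite empty; last by rewrite lt_max !gt_min b'a orbT.
  rewrite (@ger0_norm _ (b - a')) ?(@ger0_norm _ (a - b')) ?(@ger0_norm _ (b - b'))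
    ?(@ger0_norm _ (a - a')); by lra.
rewrite intR_indic; last by rewrite ge_max !le_min ab a'b ab'' ab'.
rewrite (@ger0_norm _ (b - a')) ?(@ler0_norm _ (a - b')); [|by lra|by lra].
have [aa'|aa'] := leP a a'; have [bb'|bb'] := leP b b'.
- by rewrite (@ler0_norm _ (b - b')) ?(@ler0_norm _ (a - a')); lra.
- by rewrite (@ger0_norm _ (b - b')) ?(@ler0_norm _ (a - a')); lra.
- by rewrite (@ler0_norm _ (b - b')) ?(@ger0_norm _ (a - a')); lra.
- by rewrite (@ger0_norm _ (b - b')) ?(@ger0_norm _ (a - a')); lra.
Qed.

Lemma is_derive_mull (c x : R) : is_derive x 1 (fun y : R => c * y) c.
Proof.
have h := is_deriveM (is_derive_cst c x 1) (is_derive_id x 1).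
by apply: (is_derive_eq h); rewrite /GRing.scale /= mulr1 mulr0 addr0.
Qed.

(** The fundamental theorem of calculus, Phi being an antiderivative of the kernel
phi. *)
Lemma kernel_transform_indic (phi Phi : R -> R) (a b xi : R) : a <= b -> xi != 0 ->
  continuous phi -> (forall x : R, is_derive x 1 Phi (phi x)) ->
  kernel_transform phi (itv_indic a b) xi = (Phi (xi * b) - Phi (xi * a)) / xi.
Proof.
move=> ab xi0 cphi dPhi.
have cphi' : continuous (fun x : R => phi (xi * x)).
  move=> x; apply: (@continuous_comp _ _ _ (fun x : R => xi * x) phi).
    by apply: cvgM; [exact: cvg_cst|exact: cvg_id].
  exact: cphi.
rewrite /kernel_transform /intR.
have -> : \int[mu]_x (itv_indic a b x * phi (xi * x)) =
    \int[mu]_(x in `]a, b]) phi (xi * x).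
  rewrite [RHS]Rintegral_mkcond; apply: eq_Rintegral => x _.
  rewrite /itv_indic indicE patchE; case: ifPn => _; by rewrite ?mul1r ?mul0r.
move: ab; rewrite le_eqVlt => /predU1P[<-|ab].
  by rewrite set_itvoc0 Rintegral_set0 subrr mul0r.
have dF (x : R) : is_derive x 1 (fun x : R => Phi (xi * x) / xi) (phi (xi * x)).
  have := @is_derive1_comp R Phi (fun x => xi * x) x (phi (xi * x)) xi (dPhi _)
    (is_derive_mull xi x).
  move=> h; apply: (is_derive_eq (is_deriveM h (is_derive_cst _ _ _))).
  by rewrite scaler0 add0r /GRing.scale /= mulrC mulfK.
have cF : continuous (fun x : R => Phi (xi * x) / xi).
  move=> x; apply: differentiable_continuous.
  by apply/derivable1_diffP; exact: (@ex_derive _ _ _ _ _ _ _ (dF x)).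
rewrite /Rintegral integral_itv_obnd_cbnd; last first.
  apply/measurable_EFinP; apply: measurable_funTS.
  exact: continuous_measurable_fun.
rewrite (@continuous_FTC2 _ _ (fun x => Phi (xi * x) / xi)) //.
- by rewrite -EFinB /= mulrBl.
- exact: continuous_subspaceT.
- split.
  + by move=> x _; exact: (@ex_derive _ _ _ _ _ _ _ (dF x)).
  + by apply: cvg_at_right_filter; exact: cF.
  + by apply: cvg_at_left_filter; exact: cF.
- by move=> x _; rewrite derive1E; exact: (@derive_val _ _ _ _ _ _ _ (dF x)).
Qed.

End step_functions.

(** * The transforms of step functions are isometric up to a constant *)

(* Keeps unification from unfolding integrals when it compares them. *)
Local Opaque intR.

Section step_isometry.
Context {R : realType}.
Local Notation mu := (@lebesgue_measure R).
Local Notation q := one_minus_cos_quot.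
Local Notation C := (kernel_transform cos).
Local Notation S := (kernel_transform sin).
Local Notation bcos := bounded_kernel_cos.
Local Notation bsin := bounded_kernel_sin.
Implicit Types (u v w : R -> R) (c : R).

(** The value is 2 pi, see [fourier_constE]. *)
Definition fourier_const : R := 2 * intR (q 1).
Local Notation K := fourier_const.

(** The real part of the inner product of the unnormalized Fourier transforms of two
real functions. *)
Definition spectral_dot u v : R :=
  intR (fun x => C u x * C v x) + intR (fun x => S u x * S v x).

Definition has_L2_transforms u := [/\ L1 u, L2 u, L2 (C u) & L2 (S u)].

Lemma ae_neq0 : {ae mu, forall x : R, x != 0}.
Proof.
exists [set 0 : R]; split => //; first exact: lebesgue_measure_set1.
by move=> x /= /negP; rewrite negbK => /eqP.
Qed.

(** The addition formula for cos turns the product of two differences into four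
cosines of differences; the constants 1 cancel. *)
Lemma spectral_density_indic (a b a' b' x : R) : a <= b -> a' <= b' -> x != 0 ->
  C (itv_indic a b) x * C (itv_indic a' b') x +
  S (itv_indic a b) x * S (itv_indic a' b') x =
  q (b - a') x + q (a - b') x - q (b - b') x - q (a - a') x.
Proof.
move=> ab ab' x0.
have Cd (a1 b1 : R) : a1 <= b1 ->
    C (itv_indic a1 b1) x = (sin (x * b1) - sin (x * a1)) / x.
  by move=> h; apply: kernel_transform_indic => //; exact: continuous_cos.
have Sd (a1 b1 : R) : a1 <= b1 ->
    S (itv_indic a1 b1) x = (- cos (x * b1) - - cos (x * a1)) / x.
  move=> h; apply: (@kernel_transform_indic _ sin (fun x => - cos x)) => //.
    exact: continuous_sin.
  move=> y; have h' := is_deriveN (is_derive_cos y).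
  by apply: (is_derive_eq h'); rewrite opprK.
rewrite !Cd // !Sd // /q !mulrBl ![_ * x]mulrC !cosB.
by field.
Qed.

Lemma L1_one_minus_cos_quot4 (t1 t2 t3 t4 : R) : L1 (fun x => q t1 x + q t2 x - q t3 x - q t4 x).
Proof. by do 2 (apply: L1B; last exact: L1_one_minus_cos_quot); apply: L1D; exact: L1_one_minus_cos_quot. Qed.

Lemma L1_spectral_density_indic (a b a' b' : R) : a <= b -> a' <= b' ->
  L1 (fun x => C (itv_indic a b) x * C (itv_indic a' b') x +
               S (itv_indic a b) x * S (itv_indic a' b') x) /\
  intR (fun x => q (b - a') x + q (a - b') x - q (b - b') x - q (a - a') x) =
  intR (fun x => C (itv_indic a b) x * C (itv_indic a' b') x +
               S (itv_indic a b) x * S (itv_indic a' b') x).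
Proof.
move=> ab ab'; apply: L1_ae_eq; first exact: L1_one_minus_cos_quot4.
- apply: measurable_funD; apply: measurable_funM; apply: measurable_kernel_transform;
    by [exact: bcos|exact: bsin|exact: L1_itv_indic].
- by apply: aeS ae_neq0 => x x0; rewrite spectral_density_indic.
Qed.

Lemma has_L2_transforms_indic (a b : R) : a <= b -> has_L2_transforms (itv_indic a b).
Proof.
move=> ab; have [h _] := L1_spectral_density_indic ab ab.
split; [exact: L1_itv_indic|exact: L2_itv_indic|..].
- apply: (L2_le _ h) => [|x]; first exact: (measurable_kernel_transform bcos (L1_itv_indic _ _)).
  by rewrite -!expr2 lerDl sqr_ge0.
- apply: (L2_le _ h) => [|x]; first exact: (measurable_kernel_transform bsin (L1_itv_indic _ _)).
  by rewrite -!expr2 lerDr sqr_ge0.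
Qed.

(** Integrating [spectral_density_indic] gives |b - a'| + |a - b'| - |b - b'| - |a -
a'|, which is twice the length of the intersection. *)
Lemma spectral_dot_indic (a b a' b' : R) : a <= b -> a' <= b' ->
  spectral_dot (itv_indic a b) (itv_indic a' b') =
  K * intR (fun x => itv_indic a b x * itv_indic a' b' x).
Proof.
move=> ab ab'; have [_ _ hc hs] := has_L2_transforms_indic ab.
have [_ _ hc' hs'] := has_L2_transforms_indic ab'.
rewrite /spectral_dot -intRD; [|exact: L2M..].
have [_ <-] := L1_spectral_density_indic ab ab'.
rewrite intRB; [|by apply: L1B; [apply: L1D|]; exact: L1_one_minus_cos_quot|exact: L1_one_minus_cos_quot].
rewrite intRB; [|by apply: L1D; exact: L1_one_minus_cos_quot|exact: L1_one_minus_cos_quot].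
rewrite intRD; [|exact: L1_one_minus_cos_quot|exact: L1_one_minus_cos_quot].
by rewrite !(intR_one_minus_cos_quot (_ - _)) intR_indicM // /K; field.
Qed.

Lemma kernel_transform0 (phi : R -> R) x : kernel_transform phi (fun=> 0) x = 0.
Proof. by rewrite /kernel_transform -[RHS]intR0; apply: eq_intR => y; rewrite mul0r. Qed.

Lemma has_L2_transforms0 : has_L2_transforms (fun=> 0).
Proof.
by split; [exact: L1_0|exact: L2_0|..]; apply: L2_ext L2_0 => x;
  rewrite kernel_transform0.
Qed.

Lemma has_L2_transformsD u v : has_L2_transforms u -> has_L2_transforms v -> has_L2_transforms (fun x => u x + v x).
Proof.
move=> [u1 u2 u3 u4] [v1 v2 v3 v4]; split; [exact: L1D|exact: L2D|..].
- by apply: L2_ext (L2D u3 v3) => x; rewrite (kernel_transformD bcos).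
- by apply: L2_ext (L2D u4 v4) => x; rewrite (kernel_transformD bsin).
Qed.

Lemma has_L2_transformsZ c u : has_L2_transforms u -> has_L2_transforms (fun x => c * u x).
Proof.
move=> [u1 u2 u3 u4]; split; [exact: L1Z|exact: L2Z|..].
- by apply: L2_ext (L2Z c u3) => x; rewrite (kernel_transformZ bcos).
- by apply: L2_ext (L2Z c u4) => x; rewrite (kernel_transformZ bsin).
Qed.

Lemma has_L2_transforms_step u : step u -> has_L2_transforms u.
Proof.
elim=> [|c a b {}u ab _ ih]; first exact: has_L2_transforms0.
by apply: has_L2_transformsD => //; apply: has_L2_transformsZ; exact: has_L2_transforms_indic.
Qed.

Lemma spectral_dotC u v : spectral_dot u v = spectral_dot v u.
Proof.
rewrite /spectral_dot.
have -> : (fun x => C u x * C v x) = (fun x => C v x * C u x).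
  by apply/funext => x; rewrite mulrC.
have -> // : (fun x => S u x * S v x) = (fun x => S v x * S u x).
by apply/funext => x; rewrite mulrC.
Qed.

Lemma spectral_dotDr u v w : has_L2_transforms u -> has_L2_transforms v -> has_L2_transforms w ->
  spectral_dot u (fun x => v x + w x) = spectral_dot u v + spectral_dot u w.
Proof.
move=> [u1 u2 u3 u4] [v1 v2 v3 v4] [w1 w2 w3 w4].
have e1 : intR (fun x => C u x * C (fun x => v x + w x) x) =
    intR (fun x => C u x * C v x) + intR (fun x => C u x * C w x).
  rewrite -intRD; [|exact: L2M..]; apply: eq_intR => x.
  by rewrite (kernel_transformD bcos) // mulrDr.
have e2 : intR (fun x => S u x * S (fun x => v x + w x) x) =
    intR (fun x => S u x * S v x) + intR (fun x => S u x * S w x).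
  rewrite -intRD; [|exact: L2M..]; apply: eq_intR => x.
  by rewrite (kernel_transformD bsin) // mulrDr.
by rewrite /spectral_dot e1 e2 addrACA.
Qed.

Lemma spectral_dotZr c u v : has_L2_transforms u -> has_L2_transforms v ->
  spectral_dot u (fun x => c * v x) = c * spectral_dot u v.
Proof.
move=> [u1 u2 u3 u4] [v1 v2 v3 v4].
rewrite /spectral_dot mulrDr -(intRZ c (L2M u3 v3)) -(intRZ c (L2M u4 v4)).
have -> : (fun x => C u x * C (fun x => c * v x) x) = (fun x => c * (C u x * C v x)).
  by apply/funext => x; rewrite (kernel_transformZ bcos) // mulrCA.
have -> // : (fun x => S u x * S (fun x => c * v x) x) = (fun x => c * (S u x * S v x)).
by apply/funext => x; rewrite (kernel_transformZ bsin) // mulrCA.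
Qed.

Lemma intR_dotDr u v w : L2 u -> L2 v -> L2 w ->
  intR (fun x => u x * (v x + w x)) = intR (fun x => u x * v x) + intR (fun x => u x * w x).
Proof.
by move=> hu hv hw; rewrite -intRD; [|exact: L2M..]; apply: eq_intR => x; rewrite mulrDr.
Qed.

Lemma intR_dotZr c u v : L2 u -> L2 v ->
  intR (fun x => u x * (c * v x)) = c * intR (fun x => u x * v x).
Proof.
by move=> hu hv; rewrite -intRZ; [|exact: L2M]; apply: eq_intR => x; rewrite mulrCA.
Qed.

Lemma spectral_dotr0 u : spectral_dot u (fun=> 0) = 0.
Proof.
rewrite /spectral_dot (eq_intR (v := fun=> 0)); last by move=> x; rewrite kernel_transform0 mulr0.
rewrite [X in _ + X](eq_intR (v := fun=> 0)); last by move=> x; rewrite kernel_transform0 mulr0.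
by rewrite intR0 addr0.
Qed.

(** Linearity in the second argument; used twice, once for each argument. *)
Lemma spectral_dot_step_of_indic u (gu : has_L2_transforms u) :
  (forall a b, a <= b -> spectral_dot u (itv_indic a b) = K * intR (fun x => u x * itv_indic a b x)) ->
  forall v, step v -> spectral_dot u v = K * intR (fun x => u x * v x).
Proof.
move=> h v; elim=> [|c a b {}v ab sv ih].
  rewrite spectral_dotr0 (eq_intR (v := fun=> 0)) ?intR0 ?mulr0 // => x; exact: mulr0.
have gi := has_L2_transforms_indic ab; have gv := has_L2_transforms_step sv.
rewrite spectral_dotDr //; last exact: has_L2_transformsZ.
rewrite spectral_dotZr // ih h // intR_dotDr; last 3 first.
- by case: gu.
- by apply: L2Z; case: gi.
- by case: gv.
rewrite intR_dotZr; [ring|by case: gu|by case: gi].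
Qed.

Lemma spectral_dot_step u v : step u -> step v -> spectral_dot u v = K * intR (fun x => u x * v x).
Proof.
move=> su; apply: spectral_dot_step_of_indic; first exact: has_L2_transforms_step.
move=> a b ab; rewrite spectral_dotC.
rewrite [in RHS](eq_intR (v := fun x => itv_indic a b x * u x)); last by move=> x; rewrite mulrC.
apply: spectral_dot_step_of_indic su; first exact: has_L2_transforms_indic.
by move=> a' b' ab'; exact: spectral_dot_indic.
Qed.

End step_isometry.

(** * Step functions are dense in the intersection of L1 and L2 *)

Section density.
Import HBSimple HBNNSimple.
Context {R : realType}.
Local Notation mu := (@lebesgue_measure R).
Implicit Types (u v w : R -> R) (c : R).

Definition L12 u := L1 u /\ L2 u.
(** Measures the distance to 0 in L1 and in L2 at the same time, so that one
approximation serves both: L1 controls the transforms pointwise and L2 the norms. *)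
Definition gauge12 u : R := intR (fun x => `|u x| + u x ^+ 2).

Lemma L1_gauge12 u : L12 u -> L1 (fun x => `|u x| + u x ^+ 2).
Proof. by move=> [h1 h2]; apply: L1D; [exact: L1_norm|exact: L2_sq]. Qed.

Lemma L12D u v : L12 u -> L12 v -> L12 (fun x => u x + v x).
Proof. by move=> [? ?] [? ?]; split; [exact: L1D|exact: L2D]. Qed.

Lemma L12Z c u : L12 u -> L12 (fun x => c * u x).
Proof. by move=> [? ?]; split; [exact: L1Z|exact: L2Z]. Qed.

Lemma L12B u v : L12 u -> L12 v -> L12 (fun x => u x - v x).
Proof. by move=> [? ?] [? ?]; split; [exact: L1B|exact: L2B]. Qed.

Lemma L12_le u v : measurable_fun setT u -> L12 v -> (forall x, `|u x| <= v x) -> L12 u.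
Proof.
move=> mu_ [h1 h2] uv; split; first exact: L1_le h1 uv.
apply: (L2_le mu_ (L2_sq h2)) => x.
rewrite -real_normK ?num_real //; have := uv x; have := normr_ge0 (u x); nra.
Qed.

Lemma L12_step u : step u -> L12 u.
Proof. by move/has_L2_transforms_step => []. Qed.

Lemma gauge12D_le u v : L12 u -> L12 v -> gauge12 (fun x => u x + v x) <= 2 * (gauge12 u + gauge12 v).
Proof.
move=> hu hv; rewrite /gauge12 -intRD; [|exact: L1_gauge12..].
rewrite -intRZ; last by apply: L1D; exact: L1_gauge12.
apply: le_intR; [exact/L1_gauge12/L12D|by apply: L1Z; apply: L1D; exact: L1_gauge12|].
move=> x; have := sqrD_le (u x) (v x); have := ler_normD (u x) (v x).
have := normr_ge0 (u x); have := normr_ge0 (v x); lra.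
Qed.

Lemma gauge12Z_le c u : L12 u -> gauge12 (fun x => c * u x) <= (`|c| + c ^+ 2) * gauge12 u.
Proof.
move=> hu; rewrite /gauge12 -intRZ; last exact: L1_gauge12.
apply: le_intR; [exact/L1_gauge12/L12Z|by apply: L1Z; exact: L1_gauge12|].
move=> x; rewrite normrM exprMn.
have := normr_ge0 c; have := normr_ge0 (u x); have := sqr_ge0 c.
have := sqr_ge0 (u x); nra.
Qed.

Definition step_approx u := L12 u /\
  forall e : R, 0 < e -> exists2 s, step s & gauge12 (fun x => u x - s x) <= e.

Lemma step_approx_step u : step u -> step_approx u.
Proof.
move=> su; split; first exact: L12_step.
move=> e e0; exists u => //; rewrite /gauge12 (eq_intR (v := fun=> 0)) ?intR0 ?ltW // => x.
by rewrite subrr normr0 expr0n addr0.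
Qed.

Lemma step_approxD u v : step_approx u -> step_approx v -> step_approx (fun x => u x + v x).
Proof.
move=> [hu au] [hv av]; split; first exact: L12D.
move=> e e0; have e4 : 0 < e / 4 by apply: divr_gt0.
have [s ss hs] := au _ e4; have [t st ht] := av _ e4.
exists (fun x => s x + t x); first exact: stepD.
have := gauge12D_le (L12B hu (L12_step ss)) (L12B hv (L12_step st)).
rewrite (_ : (fun x => u x - s x + (v x - t x)) = (fun x => u x + v x - (s x + t x))).
  move=> h; apply: (le_trans h); lra.
by apply/funext => x; ring.
Qed.

Lemma step_approxZ c u : step_approx u -> step_approx (fun x => c * u x).
Proof.
move=> [hu au]; split; first exact: L12Z.
move=> e e0; have d0 : 0 < `|c| + c ^+ 2 + 1.
  by have := normr_ge0 c; have := sqr_ge0 c; lra.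
have [s ss hs] := au (e / (`|c| + c ^+ 2 + 1)) (divr_gt0 e0 d0).
exists (fun x => c * s x); first exact: stepZ.
have := gauge12Z_le c (L12B hu (L12_step ss)).
rewrite (_ : (fun x => c * (u x - s x)) = (fun x => c * u x - c * s x)).
  move=> h; apply: (le_trans h).
  have W0 : 0 <= gauge12 (fun x => u x - s x).
    by apply: intR_ge0 => x; rewrite addr_ge0 ?sqr_ge0.
  move: hs; rewrite ler_pdivlMr //; have := normr_ge0 c; have := sqr_ge0 c; nra.
by apply/funext => x; ring.
Qed.

Lemma step_approx_closed u : L12 u ->
  (forall e : R, 0 < e -> exists2 v, step_approx v & gauge12 (fun x => u x - v x) <= e) ->
  step_approx u.
Proof.
move=> hu h; split => // e e0.
have e4 : 0 < e / 4 by apply: divr_gt0.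
have [v [hv av] uv] := h _ e4; have [s ss vs] := av _ e4.
exists s => //.
have := gauge12D_le (L12B hu hv) (L12B hv (L12_step ss)).
rewrite (_ : (fun x => u x - v x + (v x - s x)) = (fun x => u x - s x)).
  move=> k; apply: (le_trans k); lra.
by apply/funext => x; ring.
Qed.

(** Dominated convergence: the differences are bounded by 2 g, so that their gauge is
dominated by 2 g + 4 g ^ 2. *)
Lemma step_approx_dominated (u_ : nat -> R -> R) u g : L12 g ->
  (forall n, step_approx (u_ n)) -> (forall n x, `|u_ n x| <= g x) ->
  (forall x, u_ n x @[n --> \oo] --> u x) -> step_approx u.
Proof.
move=> hg au ug uu.
have mu_ n : measurable_fun setT (u_ n) by case: (au n) => -[/measurable_L1].
have m_u : measurable_fun setT u by exact: (measurable_fun_cvg _ (fun x _ => uu x)).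
have lug x : `|u x| <= g x.
  by apply: (cvgr_to_le (cvg_norm (uu x))); exact: nearW.
have hu : L12 u by exact: L12_le hg lug.
apply: step_approx_closed => // e e0.
have meas_diff n : measurable_fun setT (fun x => u x - u_ n x).
  exact: measurable_funB.
have hG : L1 (fun x => 2 * g x + 4 * g x ^+ 2).
  by apply: L1D; apply: L1Z; [case: hg|case: hg => _ /L2_sq].
suff [_] : L1 (fun=> 0 : R) /\ (intR (fun x => `|u x - u_ n x| + (u x - u_ n x) ^+ 2)
    @[n --> \oo] --> intR (fun=> 0 : R)).
  rewrite intR0 => /cvgrPdist_le/(_ _ e0)[sqnorm _ /(_ sqnorm (leqnn sqnorm))].
  rewrite sub0r normrN => h; exists (u_ sqnorm) => //; exact: le_trans (ler_norm _) h.
apply: (@dominated_cvg_intR R (fun n x => `|u x - u_ n x| + (u x - u_ n x) ^+ 2) (fun=> 0)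
    _ _ hG).
- move=> n; apply: measurable_funD; first exact: measurableT_comp.
  exact: measurable_funX.
- move=> n x; rewrite ger0_norm ?addr_ge0 ?sqr_ge0 //.
  have h : `|u x - u_ n x| <= 2 * g x.
    have := ler_normB (u x) (u_ n x); have := lug x; have := ug n x; lra.
  have := h; have := normr_ge0 (u x - u_ n x).
  rewrite -[in X in _ -> _ -> X](real_normK (num_real (u x - u_ n x))); nra.
- move=> x; rewrite -[X in _ --> X]addr0.
  have d0 : u x - u_ n x @[n --> \oo] --> (0 : R).
    by rewrite -(subrr (u x)); apply: cvgB; [exact: cvg_cst|exact: uu].
  apply: cvgD; first by rewrite -(normr0 R); exact: cvg_norm.
  by rewrite -[X in _ --> X](mulr0 0); apply: cvgM.
Qed.

(** The sets A whose trace on a bounded interval has an approximable indicator form a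
lambda-system that contains the half-open intervals. *)
Lemma step_approx_measurable (A : set R) (n : nat) : measurable A ->
  step_approx (fun x => \1_A x * itv_indic (- n%:R) n%:R x).
Proof.
move=> mA.
have n0 : - n%:R <= n%:R :> R by apply: (@le_trans _ _ 0); rewrite ?oppr_le0.
pose J := itv_indic (- n%:R) n%:R : R -> R.
have aJ : step_approx J by apply: step_approx_step; exact: step_indic.
have J0 x : 0 <= J x by rewrite /J /itv_indic indicE ler0n.
pose H := [set A : set R | step_approx (fun x => \1_A x * J x)].
suff : <<s setT, @ocitv R >> `<=` H by apply; exact: mA.
(* Increasing unions become pointwise limits that are eventually constant. *)
apply: (lambda_system_subset (@ocitvI R)); last by [].
- split => //.
  + by move: aJ; rewrite /H /=; congr step_approx; apply/funext => x; rewrite indicT mul1r.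
  + move=> A1 B1 BA hA hB; rewrite /H /=.
    have := step_approxD hA (step_approxZ (-1) hB); congr step_approx; apply/funext => x.
    rewrite !indicE in_setD; have [xB|xB] := boolP (x \in B1).
      have -> : x \in A1 by rewrite inE; apply: BA; rewrite -inE.
      by rewrite /=; ring.
    by rewrite andbT mul0r mulr0 addr0.
  + move=> F ndF hF; apply: (@step_approx_dominated (fun k x => \1_(F k) x * J x) _ J) => //.
    * by case: aJ.
    * move=> k x; rewrite ger0_norm ?mulr_ge0 ?indicE ?ler0n //.
      by rewrite ler_piMl // lern1 leq_b1.
    * move=> x; apply: cvgM; last exact: cvg_cst.
      rewrite !indicE; have [|xF] := boolP (x \in _).
        rewrite inE => -[k _ Fkx]; apply: cvg_near_cst.
        exists k => // m /= km; rewrite indicE mem_set //.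
        by move/subsetPset: (ndF _ _ km); apply.
      apply: cvg_near_cst; apply: nearW => k; rewrite indicE memNset //.
      by move: xF => /negP; rewrite inE => h Fk; apply: h; exists k.
- move=> _ [[a b] _ <-]; rewrite /H /=.
  have [ab|ab] := leP a b.
    have [h|h] := leP (Num.max a (- n%:R)) (Num.min b n%:R).
      have := step_approx_step (step_indic h); congr step_approx; apply/funext => x.
      by rewrite -itv_indicM.
    have := step_approx_step (step0 (R := R)); congr step_approx; apply/funext => x.
    rewrite -[\1_ _ x]/(itv_indic a b x) itv_indicM /itv_indic set_itv_ge ?indicE ?in_set0 //.
    by rewrite bnd_simp -leNgt ltW.
  have := step_approx_step (step0 (R := R)); congr step_approx; apply/funext => x.
  by rewrite set_itv_ge ?indicE ?in_set0 ?mul0r // bnd_simp -leNgt ltW.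
Qed.

Lemma step_approx_sum (J : Type) (s : seq J) (F : J -> R -> R) :
  (forall i, step_approx (F i)) -> step_approx (fun x => \sum_(i <- s) F i x).
Proof.
move=> aF; elim: s => [|i s ih].
  by have := step_approx_step (step0 (R := R)); congr step_approx; apply/funext => x; rewrite big_nil.
by have := step_approxD (aF i) ih; congr step_approx; apply/funext => x; rewrite big_cons.
Qed.

(** Monotone approximation by simple functions, cut to growing bounded intervals so
that the level sets have finite measure. *)
Lemma step_approx_ge0 u : L12 u -> (forall x, 0 <= u x) -> step_approx u.
Proof.
move=> hu u0.
have mE : measurable_fun setT (EFin \o u) by apply/measurable_EFinP; exact: (measurable_L1 hu.1).
have Eu0 (x : R) : setT x -> (0 <= (EFin \o u) x)%E by rewrite lee_fin.
pose v := nnsfun_approx measurableT mE.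
have vu n x : v n x <= u x.
  by rewrite -lee_fin; rewrite /v nnsfun_approxE; exact: le_approx.
have cv x : v n x @[n --> \oo] --> u x.
  have h := cvg_nnsfun_approx measurableT mE Eu0 (I : setT x).
  by move/fine_cvgP : h => [_ ].
pose J n := itv_indic (- n%:R) n%:R : R -> R.
apply: (@step_approx_dominated (fun n x => v n x * J n x) _ u) => //.
- move=> n.
  have e : (fun x => \sum_(y <- finmap.enum_fset (fset_set (range (v n))))
     (y * (\1_(v n @^-1` [set y]) x * J n x))) = (fun x => v n x * J n x).
    apply/funext => x; rewrite [in RHS](fimfunE (v n)) fsbig_finite //= mulr_suml.
    by apply: eq_bigr => i _; rewrite mulrA.
  rewrite -e; apply: step_approx_sum => i; apply: step_approxZ; apply: step_approx_measurable.
  exact: measurable_sfunP.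
- move=> n x; have v0 : 0 <= v n x by exact: fun_ge0.
  have J0 : 0 <= J n x by rewrite /J /itv_indic indicE ler0n.
  rewrite ger0_norm ?mulr_ge0 //; apply: le_trans (vu n x).
  by rewrite ler_piMr // /J /itv_indic indicE lern1 leq_b1.
- move=> x; rewrite -[X in _ --> X]mulr1; apply: cvgM; first exact: cv.
  apply: cvg_near_cst; exists (Num.truncn `|x|).+1 => // n /= xn.
  have h : `|x| < n%:R by rewrite (lt_le_trans (truncnS_gt _)) // ler_nat.
  rewrite /J /itv_indic indicE mem_set //= in_itv /=.
  by move: h; rewrite ltr_norml => /andP[-> /ltW ->].
Qed.

(** Positive and negative parts. *)
Lemma step_dense u : L12 u -> step_approx u.
Proof.
move=> hu.
have ge (w : R -> R) : measurable_fun setT w -> (forall x, `|w x| <= `|u x|) -> L12 w.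
  move=> mw wu; apply: (L12_le (v := fun x => `|u x|)) => //; split.
    exact: (L1_norm hu.1).
  split; first by apply: measurableT_comp => //; exact: (measurable_L1 hu.1).
  by apply: L1_ext (L2_sq hu.2) => x; rewrite real_normK ?num_real.
have mu_ := measurable_L1 hu.1.
have hp : step_approx (fun x => (`|u x| + u x) / 2).
  apply: step_approx_ge0.
    apply: ge.
      apply: measurable_funM => //; apply: measurable_funD => //.
      exact: measurableT_comp.
    move=> x; rewrite ger0_norm; case: (ger0P (u x)); lra.
  move=> x; case: (ger0P (u x)); lra.
have hn : step_approx (fun x => (`|u x| - u x) / 2).
  apply: step_approx_ge0.
    apply: ge.
      apply: measurable_funM => //; apply: measurable_funB => //.
      exact: measurableT_comp.
    move=> x; rewrite ger0_norm; case: (ger0P (u x)); lra.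
  move=> x; case: (ger0P (u x)); lra.
have := step_approxD hp (step_approxZ (-1) hn); congr step_approx; apply/funext => x; by field.
Qed.

End density.

(** * Plancherel's identity up to a constant *)

Section plancherel_real.
Context {R : realType}.
Local Notation mu := (@lebesgue_measure R).
Local Notation C := (kernel_transform cos).
Local Notation S := (kernel_transform sin).
Local Notation bcos := bounded_kernel_cos.
Local Notation bsin := bounded_kernel_sin.
Local Notation K := (@fourier_const R).
Implicit Types (u v w : R -> R) (c : R).

Lemma fourier_const_ge0 : 0 <= K.
Proof. by rewrite /fourier_const mulr_ge0 // intR_ge0 // => x; exact: one_minus_cos_quot_ge0. Qed.

(** The transform of a difference is bounded everywhere by its L1 norm. *)
Lemma kernel_transform_cvg phi (s_ : nat -> R -> R) u : bounded_kernel phi ->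
  (forall n, L12 (s_ n)) -> L12 u ->
  (gauge12 (fun x => u x - s_ n x) @[n --> \oo] --> (0 : R)) ->
  forall x, kernel_transform phi (s_ n) x @[n --> \oo] --> kernel_transform phi u x.
Proof.
move=> bp hs hu hW x; apply/cvgrPdist_le => e e0.
move/cvgrPdist_le : hW => /(_ e e0); apply: filterS => n; rewrite sub0r normrN => h.
rewrite -(kernel_transformB bp) //; [|by case: hu|by case: (hs n)].
have hd := L12B hu (hs n).
apply: (le_trans (kernel_transform_le bp _ hd.1)); apply: le_trans h; apply: le_trans (ler_norm _).
apply: le_intR; [exact: (L1_norm hd.1)|exact: L1_gauge12|].
by move=> y; rewrite lerDl sqr_ge0.
Qed.

Lemma step_dense_seq u (d : R) : L12 u -> 0 < d ->
  exists s_ : nat -> R -> R, [/\ forall n, step (s_ n),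
   forall n, gauge12 (fun x => u x - s_ n x) <= d &
   (gauge12 (fun x => u x - s_ n x) @[n --> \oo] --> (0 : R))].
Proof.
move=> hu d0; have [_ h] := step_dense hu.
have p n : 0 < Num.min d (n.+1%:R^-1) by rewrite lt_min d0 invr_gt0 ltr0n.
pose s_ n := projT1 (cid2 (h _ (p n))).
have s1 n : step (s_ n) by rewrite /s_; case: cid2.
have s2 n : gauge12 (fun x => u x - s_ n x) <= Num.min d (n.+1%:R^-1).
  by rewrite /s_; case: cid2.
exists s_; split => //.
  by move=> n; have := s2 n; rewrite le_min => /andP[].
apply: (@squeeze_cvgr _ _ _ _ (fun=> 0) (fun n => n.+1%:R^-1)).
- apply: nearW => n; rewrite intR_ge0 /=; last first.
    by move=> x; rewrite addr_ge0 ?sqr_ge0.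
  by have := s2 n; rewrite le_min => /andP[].
- exact: cvg_cst.
- exact: cvg_harmonic.
Qed.

Lemma intR_sq_le_gauge12 u : L12 u -> intR (fun x => u x ^+ 2) <= gauge12 u.
Proof.
move=> hu; apply: le_intR; [exact: L2_sq hu.2|exact: L1_gauge12|].
by move=> x; rewrite lerDr.
Qed.

(** A substitute for the triangle inequality of the L2 norm that stays quadratic: the
right-hand side minus the left-hand side is the integral of the square of t u + (u -
s), divided by t. *)
Lemma intR_sq_le_near u s (t : R) : 0 < t -> L2 u -> L2 s ->
  intR (fun x => s x ^+ 2) <=
  (1 + t) * intR (fun x => u x ^+ 2) + (1 + t^-1) * intR (fun x => (u x - s x) ^+ 2).
Proof.
move=> t0 hu hs; have hd := L2B hu hs.
rewrite -(intRZ _ (L2_sq hu)) -(intRZ _ (L2_sq hd)).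
rewrite -(intRD (L1Z _ (L2_sq hu)) (L1Z _ (L2_sq hd))).
apply: le_intR; [exact: L2_sq|by apply: L1D; apply: L1Z; exact: L2_sq|].
move=> x; have := sqr_ge0 (t * u x + (u x - s x)).
have -> : (1 + t) * u x ^+ 2 + (1 + t^-1) * (u x - s x) ^+ 2 =
  s x ^+ 2 + t^-1 * (t * u x + (u x - s x)) ^+ 2 by field; exact: lt0r_neq0.
by move=> h; rewrite lerDl mulr_ge0 // invr_ge0 ltW.
Qed.

(** Fatou's lemma along step functions s_n tending to u, whose transforms tend to
that of u pointwise. With gauge at most t ^ 2 the bound of [intR_sq_le_near] exceeds
the square norm of u by a quantity that tends to 0 with t. *)
Lemma spectral_dot_le u : L12 u ->
  has_L2_transforms u /\ spectral_dot u u <= K * intR (fun x => u x ^+ 2).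
Proof.
move=> hu; have [h1 h2] := hu.
have iu0 : 0 <= intR (fun x => u x ^+ 2) by apply: intR_ge0 => x; exact: sqr_ge0.
have main (t : R) : 0 < t -> L1 (fun x => C u x ^+ 2 + S u x ^+ 2) /\
  intR (fun x => C u x ^+ 2 + S u x ^+ 2) <=
    K * ((1 + t) * intR (fun x => u x ^+ 2) + (t ^+ 2 + t)).
  move=> t0; have t2 : 0 < t ^+ 2 by rewrite exprn_gt0.
  have [s_ [ss sd sW]] := step_dense_seq hu t2.
  have sL n : L12 (s_ n) by exact: L12_step.
  have gs n := has_L2_transforms_step (ss n).
  apply: (@fatou_intR R (fun n x => C (s_ n) x ^+ 2 + S (s_ n) x ^+ 2)).
  - by move=> n; have [_ _ ? ?] := gs n; apply: L1D; exact: L2_sq.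
  - by move=> n x; rewrite addr_ge0 ?sqr_ge0.
  - move=> n; have [_ _ hc hs] := gs n.
    have -> : intR (fun x => C (s_ n) x ^+ 2 + S (s_ n) x ^+ 2) = spectral_dot (s_ n) (s_ n).
      by rewrite intRD //; exact: L2_sq.
    rewrite spectral_dot_step //; apply: ler_wpM2l; first exact: fourier_const_ge0.
    apply: le_trans (intR_sq_le_near t0 h2 (sL n).2) _.
    rewrite lerD2l; have -> : t ^+ 2 + t = (1 + t^-1) * t ^+ 2.
      by field; exact: lt0r_neq0.
    apply: ler_wpM2l; first by rewrite addr_ge0 // invr_ge0 ltW.
    exact: le_trans (intR_sq_le_gauge12 (L12B hu (sL n))) (sd n).
  - by apply: measurable_funD; apply: measurable_funX; apply: measurable_kernel_transform => //;
      [exact: bcos|exact: bsin].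
  - apply: aeT => x; apply: cvgD; rewrite !expr2; apply: cvgM;
      by apply: kernel_transform_cvg sW x; [exact: bcos || exact: bsin|..].
  - by move=> x; rewrite addr_ge0 ?sqr_ge0.
have [hL _] := main 1 ltr01.
have gu : has_L2_transforms u.
  split => //.
  - by apply: (L2_le _ hL) => [|x]; [exact: (measurable_kernel_transform bcos)|rewrite lerDl sqr_ge0].
  - by apply: (L2_le _ hL) => [|x]; [exact: (measurable_kernel_transform bsin)|rewrite lerDr sqr_ge0].
split => //; have [_ _ hc hs] := gu.
have -> : spectral_dot u u = intR (fun x => C u x ^+ 2 + S u x ^+ 2).
  by rewrite [RHS]intRD //; exact: L2_sq.
apply/ler_addgt0Pr => e e0.
set A := intR (fun x => u x ^+ 2) in iu0 main *.
have D0 : 0 < K * (A + 2) + 1.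
  by have := mulr_ge0 fourier_const_ge0 (addr_ge0 iu0 (ler0n R 2)); lra.
(* Small enough for K t (A + t + 1) <= e. *)
pose t := Num.min 1 (e / (K * (A + 2) + 1)).
have t0 : 0 < t by rewrite lt_min ltr01 divr_gt0.
have t1 : t <= 1 by rewrite ge_min lexx.
have te : t * (K * (A + 2) + 1) <= e by rewrite -ler_pdivlMr // ge_min lexx orbT.
apply: (le_trans (main _ t0).2).
have -> : K * ((1 + t) * A + (t ^+ 2 + t)) = K * A + K * t * (A + t + 1) by ring.
rewrite lerD2l; apply: le_trans te.
have -> : t * (K * (A + 2) + 1) = K * t * (A + 2) + t by ring.
have : K * t * (A + t + 1) <= K * t * (A + 2).
  apply: ler_wpM2l; first by rewrite mulr_ge0 ?fourier_const_ge0 ?ltW.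
  by lra.
lra.
Qed.

Lemma sq_parallelogram u v : L2 u -> L2 v ->
  intR (fun x => (u x + v x) ^+ 2) + intR (fun x => (u x - v x) ^+ 2) =
  2 * (intR (fun x => u x ^+ 2) + intR (fun x => v x ^+ 2)).
Proof.
move=> hu hv; have hp := L2D hu hv; have hm := L2B hu hv.
rewrite -(intRD (L2_sq hu) (L2_sq hv)) -(intRD (L2_sq hp) (L2_sq hm)).
rewrite -intRZ; last by apply: L1D; exact: L2_sq.
by apply: eq_intR => x; ring.
Qed.

Definition spectral_energy u := intR (fun x => C u x ^+ 2) + intR (fun x => S u x ^+ 2).

Lemma spectral_dot_energy u : spectral_dot u u = spectral_energy u.
Proof. by []. Qed.

Lemma spectral_energy_parallelogram u v : has_L2_transforms u -> has_L2_transforms v ->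
  spectral_energy (fun x => u x + v x) + spectral_energy (fun x => u x - v x) =
  2 * (spectral_energy u + spectral_energy v).
Proof.
move=> [u1 _ u3 u4] [v1 _ v3 v4]; rewrite /spectral_energy.
have -> : C (fun x => u x + v x) = (fun x => C u x + C v x).
  by apply/funext => x; rewrite (kernel_transformD bcos).
have -> : C (fun x => u x - v x) = (fun x => C u x - C v x).
  by apply/funext => x; rewrite (kernel_transformB bcos).
have -> : S (fun x => u x + v x) = (fun x => S u x + S v x).
  by apply/funext => x; rewrite (kernel_transformD bsin).
have -> : S (fun x => u x - v x) = (fun x => S u x - S v x).
  by apply/funext => x; rewrite (kernel_transformB bsin).
by rewrite addrACA (sq_parallelogram u3 v3) (sq_parallelogram u4 v4) -mulrDr addrACA.
Qed.

(** The arithmetic of the deficit argument. Here a, c, d, b stand for the energies of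
u = s + w, s, w and s - w, and A, B, D, F for the square norms: the deficit k A - a
equals 2 (k D - d) - (k F - b), hence is at most 2 k D. *)
Lemma deficit_bound (k a b c d A B D F e : R) :
  0 <= d -> 0 <= D -> D * (2 * k + 1) <= e -> a + b = 2 * (c + d) -> c = k * B ->
  b <= k * F -> A + F = 2 * (B + D) -> k * A <= a + e.
Proof.
move=> d0 D0 hD E1 E3 bF E4.
have -> : A = 2 * (B + D) - F by lra.
have -> : a = 2 * (k * B + d) - b by lra.
lra.
Qed.

(** The deficit, K times the square norm minus the energy, is nonnegative by
[spectral_dot_le] and vanishes on step functions s. By the parallelogram identity for
s and w = u - s, the deficit of u is at most twice that of w, which is arbitrarily
small. *)
Lemma plancherel_const u : L12 u -> has_L2_transforms u /\ spectral_energy u = K * intR (fun x => u x ^+ 2).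
Proof.
move=> hu; have [gu uK] := spectral_dot_le hu; split => //.
apply/eqP; rewrite eq_le -spectral_dot_energy uK /=.
apply/ler_addgt0Pr => e e0.
have D0 : 0 < 2 * K + 1 by have := fourier_const_ge0; lra.
have [s_ [ss sd _]] := step_dense_seq hu (divr_gt0 e0 D0).
have sL := L12_step (ss 0%N); have {sd} := sd 0%N; have {ss} := ss 0%N.
move: (s_ 0%N) sL => s sL ss sd {s_}.
have hw := L12B hu sL; have [gw _] := spectral_dot_le hw.
have gs := has_L2_transforms_step ss.
set w := fun x => u x - s x in hw gw sd.
have hm := L12B sL hw.
have e1 : (fun x => s x + w x) = u by apply/funext => x; rewrite /w; ring.
have := spectral_energy_parallelogram gs gw; rewrite e1 => E1.
have := sq_parallelogram sL.2 hw.2.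
rewrite (_ : (fun x => (s x + w x) ^+ 2) = (fun x => u x ^+ 2)); last first.
  by apply/funext => x; rewrite /w; ring.
have [_] := spectral_dot_le hm; rewrite spectral_dot_energy.
have E2 := spectral_dot_step ss ss; rewrite spectral_dot_energy in E2.
have E3 : spectral_energy s = K * intR (fun x => s x ^+ 2).
  by rewrite E2; congr (_ * _); apply: eq_intR => x; rewrite expr2.
have D_ge0 : 0 <= intR (fun x => w x ^+ 2) by apply: intR_ge0 => x; exact: sqr_ge0.
have hwd : intR (fun x => w x ^+ 2) <= e / (2 * K + 1) := le_trans (intR_sq_le_gauge12 hw) sd.
have Ew0 : 0 <= spectral_energy w by apply: addr_ge0; apply: intR_ge0 => x; exact: sqr_ge0.
move: Ew0 D_ge0 hwd E1 E3; rewrite ler_pdivlMr // => d0 D0' hD E1 E3.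
move=> bF E4.
apply: (deficit_bound d0 D0' hD E1 E3 bF E4).
Qed.

End plancherel_real.

(** * The value of the constant *)

Section constant.
Context {R : realType}.
Local Notation mu := (@lebesgue_measure R).
Local Notation C := (kernel_transform cos).
Local Notation S := (kernel_transform sin).
Local Notation bcos := bounded_kernel_cos.
Local Notation bsin := bounded_kernel_sin.
Local Notation K := (@fourier_const R).
Implicit Types (u v w : R -> R) (c : R).

(** The test function that determines the constant: its square norm is 1 / 2 and its
cosine and sine transforms are 1 / (1 + x ^ 2) and x / (1 + x ^ 2), whose squares add
up to 1 / (1 + x ^ 2). *)
Definition half_exp : R -> R := fun x => \1_`[0, +oo[%classic x * expR (- x).
Local Notation u0 := half_exp.

Lemma expN_cvg0 (b : R -> R) (M : R) : (forall x, `|b x| <= M) ->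
  expR (- x) * b x @[x --> +oo] --> (0 : R).
Proof.
move=> bM; apply/cvgr0Pnorm_le => e e0.
have M0 : 0 <= M by apply: le_trans (bM 0).
exists (M / e); split; first exact: num_real.
move=> x Mx; rewrite normrM ger0_norm ?expR_ge0 //.
have x1 : M / e < expR x.
  by apply: lt_le_trans Mx _; have := expR_ge1Dx x; lra.
have E0 := expR_gt0 x.
rewrite expRN mulrC ler_pdivrMr //.
apply: le_trans (bM x) _; rewrite mulrC -ler_pdivrMr //; exact: ltW.
Qed.

Lemma half_exp_ge0 x : 0 <= u0 x.
Proof. by rewrite mulr_ge0 ?expR_ge0 // indicE. Qed.

(** The constant 2 makes the integrand nonnegative, as the fundamental theorem of
calculus on a half line requires; it is subtracted again in the applications. *)
Lemma half_exp_trig (xi al be : R) : `|al| <= 1 -> `|be| <= 1 ->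
  L1 (fun x => u0 x * (2 + al * cos (xi * x) + be * sin (xi * x))) /\
  intR (fun x => u0 x * (2 + al * cos (xi * x) + be * sin (xi * x))) =
  2 + (al + be * xi) / (1 + xi ^+ 2).
Proof.
move=> hal hbe.
pose h (x : R) := 2 + al * cos (xi * x) + be * sin (xi * x).
pose f (x : R) := expR (- x) * h x.
(* expR (- x) * g x is the antiderivative vanishing at infinity, up to sign. *)
pose g (x : R) := 2 + (al * (cos (xi * x) - xi * sin (xi * x))
    + be * (xi * cos (xi * x) + sin (xi * x))) / (1 + xi ^+ 2).
pose F (x : R) := - (expR (- x) * g x).
have d0 : 0 < 1 + xi ^+ 2 by have := sqr_ge0 xi; lra.
have h0 x : 0 <= h x.
  have : `|al * cos (xi * x)| <= 1 by rewrite normrM mulr_ile1 // cos_max.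
  have : `|be * sin (xi * x)| <= 1 by rewrite normrM mulr_ile1 // sin_max.
  by rewrite !ler_norml /h => /andP[? _] /andP[? _]; lra.
have f0 x : 0 <= f x by rewrite mulr_ge0 // expR_ge0.
have dcos (x : R) : is_derive x 1 (fun x : R => cos (xi * x)) (- sin (xi * x) * xi).
  exact: (@is_derive1_comp R cos (fun x => xi * x) x _ xi (is_derive_cos _)
    (is_derive_mull xi x)).
have dsin (x : R) : is_derive x 1 (fun x : R => sin (xi * x)) (cos (xi * x) * xi).
  exact: (@is_derive1_comp R sin (fun x => xi * x) x _ xi (is_derive_sin _)
    (is_derive_mull xi x)).
have dexp (x : R) : is_derive x 1 (fun x : R => expR (- x)) (- expR (- x)).
  have dl : is_derive x 1 (fun x : R => - x) (-1) by exact: is_deriveN.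
  have := @is_derive1_comp R expR (fun x => - x) x _ _ (is_derive_expR _) dl.
  by move=> hh; apply: (is_derive_eq hh); rewrite mulrN1.
have dg (x : R) : is_derive x 1 g
  ((al * (- sin (xi * x) * xi - xi * (cos (xi * x) * xi)) +
   be * (xi * (- sin (xi * x) * xi) + cos (xi * x) * xi)) / (1 + xi ^+ 2)).
  rewrite /g.
  by apply: is_derive_eq; rewrite /GRing.scale /=; field; exact: lt0r_neq0.
have dF (x : R) : is_derive x 1 F (f x).
  rewrite /F; apply: is_derive_eq; rewrite /GRing.scale /= /f /g /h.
  by field; exact: lt0r_neq0.
have cexp : continuous (fun x : R => expR (- x)).
  move=> x; apply: differentiable_continuous; apply/derivable1_diffP.
  exact: (@ex_derive _ _ _ _ _ _ _ (dexp x)).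
have cF : continuous F.
  move=> x; apply: differentiable_continuous; apply/derivable1_diffP.
  exact: (@ex_derive _ _ _ _ _ _ _ (dF x)).
have ch : continuous h.
  move=> x; rewrite /h; apply: cvgD; first apply: cvgD; first exact: cvg_cst.
  - by apply: cvgM; [exact: cvg_cst|exact: (continuous_kernel bcos)].
  - by apply: cvgM; [exact: cvg_cst|exact: (continuous_kernel bsin)].
have cf : continuous f by move=> x; apply: cvgM; [exact: cexp|exact: ch].
have F_lim : F x @[x --> +oo] --> (0 : R).
  rewrite -oppr0; apply: cvgN.
  apply: (@expN_cvg0 g (2 + (2 + 2 * `|xi|) / (1 + xi ^+ 2))) => x.
  have trig (a b : R) : `|a| <= 1 -> `|b| <= 1 -> `|a * b| <= 1.
    by move=> ha hb; rewrite normrM mulr_ile1.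
  have trig' (a b : R) : `|a| <= 1 -> `|b| <= 1 -> `|a * (xi * b)| <= `|xi|.
    by move=> ha hb; rewrite mulrCA normrM ler_piMr // trig.
  have := trig _ _ hal (cos_max (xi * x)); have := trig' _ _ hal (sin_max (xi * x)).
  have := trig _ _ hbe (sin_max (xi * x)); have := trig' _ _ hbe (cos_max (xi * x)).
  rewrite /g => h1 h2 h3 h4.
  apply: le_trans (ler_normD _ _) _; rewrite (ger0_norm (ler0n R 2)) lerD2l.
  rewrite normrM normfV (gtr0_norm d0) ler_pM2r ?invr_gt0 //.
  move: h1 h2 h3 h4; rewrite !ler_norml.
  move=> /andP[? ?] /andP[? ?] /andP[? ?] /andP[? ?]; apply/andP; split; lra.
have e : (\int[mu]_(x in `[0%R, +oo[) (f x)%:E = 0%:E - (F 0)%:E)%E.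
  apply: ge0_continuous_FTC2y => //.
  - exact: continuous_subspaceT.
  - by apply: cvg_at_right_filter; exact: cF.
  - by move=> x _; rewrite derive1E; exact: (@derive_val _ _ _ _ _ _ _ (dF x)).
have ext x : u0 x * (2 + al * cos (xi * x) + be * sin (xi * x)) =
    (f \_ `[0, +oo[%classic) x.
  by rewrite /u0 indicE patchE -/(h x); case: ifPn => _; rewrite ?mul1r ?mul0r.
have e' : (\int[mu]_x (u0 x * (2 + al * cos (xi * x) + be * sin (xi * x)))%:E =
    (- F 0)%:E)%E.
  transitivity (\int[mu]_(x in `[0%R, +oo[) (f x)%:E)%E; last by rewrite e sub0e.
  rewrite [RHS]integral_mkcond; apply: eq_integral => x _.
  by rewrite ext !patchE; case: ifP.
have hL : L1 (fun x => u0 x * (2 + al * cos (xi * x) + be * sin (xi * x))).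
  apply: L1_nonneg.
  - apply: measurable_funM; last exact: continuous_measurable_fun.
    apply: measurable_funM; last exact: continuous_measurable_fun.
    exact: measurable_indic.
  - by move=> x; apply: mulr_ge0; [exact: half_exp_ge0|exact: h0].
  - by rewrite e' ltry.
split => //; apply: EFin_inj; rewrite intRE // e'; congr EFin.
by rewrite /F /g /= opprK oppr0 expR0 !mulr0 cos0 sin0; ring.
Qed.

Lemma half_exp_le1 x : u0 x <= 1.
Proof.
rewrite /half_exp indicE; case: (boolP (x \in _)) => [|_]; last by rewrite mul0r.
by rewrite inE /= in_itv /= andbT mul1r => x0; rewrite -expR0 ler_expR oppr_le0.
Qed.

Lemma half_exp_L1 : L1 u0 /\ intR u0 = 1.
Proof.
have n0 : `|0 : R| <= 1 by rewrite normr0.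
have [h1 h2] := half_exp_trig 0 n0 n0.
have e x : 2^-1 * (u0 x * (2 + 0 * cos (0 * x) + 0 * sin (0 * x))) = u0 x by field.
split; first by apply: (L1_ext e); exact: L1Z.
by rewrite -(eq_intR e) intRZ // h2; field.
Qed.

(** Squaring the exponential is a dilation, so that the square norm follows from the
integral. *)
Lemma half_exp_sqr x : u0 x ^+ 2 = u0 (2 * x).
Proof.
rewrite /half_exp exprMn [expR _ ^+ 2]expr2 -expRD.
have -> : - x + - x = - (2 * x) by ring.
congr (_ * _); rewrite !indicE.
have -> : (2 * x \in `[0, +oo[%classic) = (x \in `[0, +oo[%classic).
  by apply/idP/idP; rewrite !inE /= !in_itv /= !andbT pmulr_rge0.
by case: (_ \in _); rewrite ?expr1n ?expr0n.
Qed.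

Lemma half_exp_L12 : L12 u0.
Proof.
have [h1 _] := half_exp_L1; split => //.
apply: (L2_le (measurable_L1 h1) h1) => x.
by rewrite expr2 ler_piMl ?half_exp_ge0 ?half_exp_le1.
Qed.

Lemma half_exp_sq : intR (fun x => u0 x ^+ 2) = 2^-1.
Proof.
have [h1 h2] := half_exp_L1.
have h3 : L1 (fun x => u0 (2 * x)).
  by apply: L1_ext half_exp_sqr _; exact: L2_sq half_exp_L12.2.
rewrite (eq_intR half_exp_sqr).
have h : intR u0 = 2 * intR (fun x => u0 (2 * x)).
  apply: EFin_inj; rewrite EFinM !intRE //.
  by apply: ge0_integral_dilation => //; [exact: measurable_L1|exact: half_exp_ge0].
move: h; rewrite h2; move: (intR _) => a h; lra.
Qed.

Lemma cos_half_exp xi : C u0 xi = (1 + xi ^+ 2)^-1.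
Proof.
have n0 : `|0 : R| <= 1 by rewrite normr0.
have n1 : `|1 : R| <= 1 by rewrite normr1.
have [h1 h2] := half_exp_trig xi n1 n0.
have [k1 k2] := half_exp_L1.
have <- : intR (fun x => u0 x * (2 + 1 * cos (xi * x) + 0 * sin (xi * x)) - 2 * u0 x) = C u0 xi.
  by apply: eq_intR => x; ring.
rewrite intRB //; last exact: L1Z.
by rewrite intRZ // h2 k2; ring.
Qed.

Lemma sin_half_exp xi : S u0 xi = xi / (1 + xi ^+ 2).
Proof.
have n0 : `|0 : R| <= 1 by rewrite normr0.
have n1 : `|1 : R| <= 1 by rewrite normr1.
have [h1 h2] := half_exp_trig xi n0 n1.
have [k1 k2] := half_exp_L1.
have <- : intR (fun x => u0 x * (2 + 0 * cos (xi * x) + 1 * sin (xi * x)) - 2 * u0 x) = S u0 xi.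
  by apply: eq_intR => x; ring.
rewrite intRB //; last exact: L1Z.
by rewrite intRZ // h2 k2; ring.
Qed.

(** Plancherel's identity for [half_exp] reads pi = K / 2. *)
Lemma fourier_constE : K = 2 * pi.
Proof.
have [[_ _ gc gs] E] := plancherel_const half_exp_L12.
have h : spectral_energy u0 = pi.
  rewrite /spectral_energy -intRD; [|exact: L2_sq..].
  rewrite -intR_oneDsqr.2; apply: eq_intR => x; rewrite cos_half_exp sin_half_exp.
  have d0 : 1 + x ^+ 2 != 0 by rewrite lt0r_neq0 //; have := sqr_ge0 x; lra.
  by field.
by move: E; rewrite h half_exp_sq => ->; field.
Qed.

Lemma plancherel_real u : L12 u -> has_L2_transforms u /\ spectral_energy u = 2 * pi * intR (fun x => u x ^+ 2).
Proof. by move=> /plancherel_const; rewrite fourier_constE. Qed.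

End constant.

(** * Square-integrable complex functions *)

Section complex_functions.
Context {R : realType}.
Local Notation mu := (@lebesgue_measure R).
Local Notation C := (kernel_transform cos).
Local Notation S := (kernel_transform sin).
Local Notation bcos := bounded_kernel_cos.
Local Notation bsin := bounded_kernel_sin.
Implicit Types (g h : R -> R[i]) (z w : R[i]).

Definition re g : R -> R := fun x => complex.Re (g x).
Definition im g : R -> R := fun x => complex.Im (g x).
Definition sqmod (z : R[i]) : R := complex.Re z ^+ 2 + complex.Im z ^+ 2.

Definition cL1 g := L1 (re g) /\ L1 (im g).
Definition cL2 g := L2 (re g) /\ L2 (im g).
Definition sqnorm g : R := intR (fun x => sqmod (g x)).

Lemma sqmod_ge0 z : 0 <= sqmod z.
Proof. by rewrite addr_ge0 ?sqr_ge0. Qed.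

Lemma cnormE z : cnorm z = Num.sqrt (sqmod z).
Proof. by case: z. Qed.

Lemma cnorm_sqr z : cnorm z ^+ 2 = sqmod z.
Proof. by rewrite cnormE sqr_sqrtr // sqmod_ge0. Qed.

Lemma cnorm_ge0 z : 0 <= cnorm z.
Proof. by rewrite cnormE sqrtr_ge0. Qed.

Lemma sqmodM z w : sqmod (z * w) = sqmod z * sqmod w.
Proof. by case: z => a b; case: w => c d; rewrite /sqmod /=; ring. Qed.

Lemma measurable_sqmod g : cmeasurable g -> measurable_fun setT (fun x => sqmod (g x)).
Proof.
by move=> [m1 m2]; apply: measurable_funD; exact: measurable_funX.
Qed.

Lemma Lpnorm2E g : Lpnorm 2 g =
  poweR (\int[mu]_x (sqmod (g x))%:E)%E 2^-1.
Proof.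
rewrite /Lpnorm unlock; congr (poweR _ _); apply: eq_integral => x _.
rewrite gee0_abs ?lee_fin ?cnorm_ge0 // poweR_EFin; congr EFin.
by rewrite -cnorm_sqr -powR_mulrn ?cnorm_ge0.
Qed.

Lemma cL2_meas g : cL2 g -> cmeasurable g.
Proof. by move=> [[? _] [? _]]. Qed.

Lemma L1_sqmod g : cL2 g -> L1 (fun x => sqmod (g x)).
Proof. by move=> [h1 h2]; apply: L1D; exact: L2_sq. Qed.

Lemma sqnorm_split g : cL2 g -> sqnorm g = intR (fun x => re g x ^+ 2) + intR (fun x => im g x ^+ 2).
Proof. by move=> [h1 h2]; rewrite -intRD //; exact: L2_sq. Qed.

Lemma sqnorm_ge0 g : 0 <= sqnorm g.
Proof. by apply: intR_ge0 => x; exact: sqmod_ge0. Qed.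

Lemma cL2_le g (b : R -> R) : cmeasurable g -> L1 b -> (forall x, sqmod (g x) <= b x) -> cL2 g.
Proof.
move=> [m1 m2] hw gw; split; apply: (L2_le _ hw) => // x;
  apply: le_trans (gw x); by rewrite ?lerDl ?lerDr sqr_ge0.
Qed.

Lemma Lpnorm2_sqnorm g : cL2 g -> Lpnorm 2 g = (Num.sqrt (sqnorm g))%:E.
Proof.
move=> hg; rewrite Lpnorm2E -intRE; last exact: L1_sqmod.
by rewrite poweR_EFin powR12_sqrt // sqnorm_ge0.
Qed.

Lemma Lpfun2P g : Lpfun 2 g <-> cL2 g.
Proof.
split=> [[mg]|hg]; last by split; [exact: cL2_meas|rewrite Lpnorm2_sqnorm // ltry].
rewrite Lpnorm2E => h; apply: (cL2_le mg (b := fun x => sqmod (g x))) => //.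
apply: L1_nonneg => [|x|]; [exact: measurable_sqmod|exact: sqmod_ge0|].
by rewrite ltey; apply/negP => /eqP e; move: h; rewrite e poweRyr.
Qed.

(** The modulus and the sum of the absolute values of the real and imaginary parts
dominate each other. *)
Lemma Lpfun1P g : Lpfun 1 g <-> cL1 g.
Proof.
have nle z : `|complex.Re z| <= cnorm z /\ `|complex.Im z| <= cnorm z.
  rewrite cnormE -!sqrtr_sqr; split; apply: ler_wsqrtr;
  by rewrite ?lerDl ?lerDr sqr_ge0.
have leN z : cnorm z <= `|complex.Re z| + `|complex.Im z|.
  rewrite -(@ler_pXn2r _ 2) // ?nnegrE ?cnorm_ge0 ?addr_ge0 // cnorm_sqr.
  rewrite sqrrD !real_normK ?num_real // addrAC lerDl.
  by rewrite mulrn_wge0 // mulr_ge0.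
have mc : cmeasurable g -> measurable_fun setT (fun x => cnorm (g x)).
  move=> mg; have -> : (fun x => cnorm (g x)) = (fun x => sqmod (g x) `^ 2^-1).
    by apply/funext => x; rewrite cnormE powR12_sqrt // sqmod_ge0.
  by apply: (measurableT_comp (measurable_powR _)); exact: measurable_sqmod.
have E1 : Lpnorm 1 g = (\int[mu]_x (cnorm (g x))%:E)%E.
  rewrite /Lpnorm Lnorm1; apply: eq_integral => x _.
  by rewrite gee0_abs ?lee_fin ?cnorm_ge0.
split=> [[mg]|[h1 h2]].
  rewrite E1 => h.
  have hc : L1 (fun x => cnorm (g x)).
    by apply: L1_nonneg => [|x|//]; [exact: mc|exact: cnorm_ge0].
  by case: mg => m1 m2; split; apply: (L1_le _ hc) => // x; have [] := nle (g x).
have mg : cmeasurable g by split; exact: measurable_L1.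
split => //; rewrite E1.
have hc : L1 (fun x => cnorm (g x)).
  apply: (L1_le (mc mg) (L1D (L1_norm h1) (L1_norm h2))) => x.
  by rewrite ger0_norm ?cnorm_ge0.
by rewrite -intRE // ltry.
Qed.

Lemma reB g h x : re (g \- h) x = re g x - re h x.
Proof. by rewrite /re /=; case: (g x) => a b; case: (h x). Qed.
Lemma imB g h x : im (g \- h) x = im g x - im h x.
Proof. by rewrite /im /=; case: (g x) => a b; case: (h x). Qed.
Lemma reD g h x : re (g \+ h) x = re g x + re h x.
Proof. by rewrite /re /=; case: (g x) => a b; case: (h x). Qed.
Lemma imD g h x : im (g \+ h) x = im g x + im h x.
Proof. by rewrite /im /=; case: (g x) => a b; case: (h x). Qed.

Lemma cL1B g h : cL1 g -> cL1 h -> cL1 (g \- h).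
Proof.
move=> [g1 g2] [h1 h2]; split.
  by apply: L1_ext (L1B g1 h1) => x; rewrite reB.
by apply: L1_ext (L1B g2 h2) => x; rewrite imB.
Qed.

Lemma cL2B g h : cL2 g -> cL2 h -> cL2 (g \- h).
Proof.
move=> [g1 g2] [h1 h2]; split.
  by apply: L2_ext (L2B g1 h1) => x; rewrite reB.
by apply: L2_ext (L2B g2 h2) => x; rewrite imB.
Qed.

Lemma cL2D g h : cL2 g -> cL2 h -> cL2 (g \+ h).
Proof.
move=> [g1 g2] [h1 h2]; split.
  by apply: L2_ext (L2D g1 h1) => x; rewrite reD.
by apply: L2_ext (L2D g2 h2) => x; rewrite imD.
Qed.

Lemma sqmodN z : sqmod (- z) = sqmod z.
Proof. by case: z => a b; rewrite /sqmod /= !sqrrN. Qed.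

Lemma sqnormBC g h : sqnorm (g \- h) = sqnorm (h \- g).
Proof. by apply: eq_intR => x; rewrite /= -sqmodN opprB. Qed.

Lemma sqmodD_le z w : sqmod (z + w) <= 2 * (sqmod z + sqmod w).
Proof.
case: z => a b; case: w => c d; rewrite /sqmod /=.
by have := sqrD_le a c; have := sqrD_le b d; lra.
Qed.

Lemma sqnormB_triangle g h k : cL2 g -> cL2 h -> cL2 k ->
  sqnorm (g \- k) <= 2 * (sqnorm (g \- h) + sqnorm (h \- k)).
Proof.
move=> hg hh hk; rewrite /sqnorm -intRD; [|exact/L1_sqmod/cL2B..].
rewrite -intRZ; last by apply: L1D; exact/L1_sqmod/cL2B.
apply: le_intR; [exact/L1_sqmod/cL2B|by apply/L1Z/L1D; exact/L1_sqmod/cL2B|].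
by move=> x /=; apply: le_trans (sqmodD_le _ _); rewrite addrA subrK.
Qed.

(** The pointwise version of [intR_sq_le_near] for complex values. *)
Lemma sqmod_le_near z w (t : R) : 0 < t ->
  sqmod w <= (1 + t) * sqmod z + (1 + t^-1) * sqmod (z - w).
Proof.
move=> t0; case: z => a b; case: w => c d; rewrite /sqmod /=.
have e (x y : R) : y ^+ 2 <= (1 + t) * x ^+ 2 + (1 + t^-1) * (x - y) ^+ 2.
  have -> : (1 + t) * x ^+ 2 + (1 + t^-1) * (x - y) ^+ 2 =
    y ^+ 2 + t^-1 * (t * x + (x - y)) ^+ 2 by field; exact: lt0r_neq0.
  by rewrite lerDl mulr_ge0 ?sqr_ge0 // invr_ge0 ltW.
by have := e a c; have := e b d; lra.
Qed.

Lemma sqnorm_le_near g h (t : R) : 0 < t -> cL2 g -> cL2 h ->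
  sqnorm h <= (1 + t) * sqnorm g + (1 + t^-1) * sqnorm (g \- h).
Proof.
move=> t0 hg hh; rewrite /sqnorm.
have k1 := L1Z (1 + t) (L1_sqmod hg).
have k2 := L1Z (1 + t^-1) (L1_sqmod (cL2B hg hh)).
rewrite -(intRZ _ (L1_sqmod hg)) -(intRZ _ (L1_sqmod (cL2B hg hh))) -(intRD k1 k2).
apply: le_intR; [exact: L1_sqmod|exact: L1D|].
by move=> x; exact: sqmod_le_near.
Qed.

Lemma sqnormB_eq0_ae g h : cL2 g -> cL2 h -> sqnorm (g \- h) = 0 -> {ae mu, forall x, g x = h x}.
Proof.
move=> hg hh N0.
have := intR_eq0_ae (L1_sqmod (cL2B hg hh)) (fun x => sqmod_ge0 _) N0.
apply: aeS => x /=; case: (g x) => a b; case: (h x) => c d; rewrite /sqmod /=.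
move=> /eqP; rewrite paddr_eq0 ?sqr_ge0 // !sqrf_eq0 !subr_eq0.
by move=> /andP[/eqP -> /eqP ->].
Qed.

End complex_functions.

(** * Plancherel's identity for complex functions *)

Section plancherel_complex.
Context {R : realType}.
Local Notation mu := (@lebesgue_measure R).
Local Notation C := (kernel_transform cos).
Local Notation S := (kernel_transform sin).
Local Notation bcos := bounded_kernel_cos.
Local Notation bsin := bounded_kernel_sin.
Implicit Types (g h : R -> R[i]) (z w : R[i]).

Local Notation k := ((Num.sqrt (2 * pi))^-1 : R).

(** The real and imaginary parts of the transform in terms of the cosine and sine
transforms. *)
Lemma fourier1E g xi : cL1 g ->
  fourier1 g xi = (k * (C (re g) xi + S (im g) xi)) +i* (k * (C (im g) xi - S (re g) xi)).
Proof.
move=> [g1 g2]; rewrite /fourier1 /cintegral.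
have -> : \int[mu]_x complex.Re (g x * expi (- (xi * x))) = C (re g) xi + S (im g) xi.
  rewrite -intRD; [|exact: (L1_kernel bcos)|exact: (L1_kernel bsin)].
  apply: eq_intR => x; rewrite /expi /re /im; case: (g x) => a b /=.
  by rewrite cosN sinN; ring.
have -> : \int[mu]_x complex.Im (g x * expi (- (xi * x))) = C (im g) xi - S (re g) xi.
  rewrite -intRB; [|exact: (L1_kernel bcos)|exact: (L1_kernel bsin)].
  apply: eq_intR => x; rewrite /expi /re /im; case: (g x) => a b /=.
  by rewrite cosN sinN; ring.
by apply/eqP; rewrite eq_complex /= !mul0r subr0 addr0 !eqxx.
Qed.

Lemma re_fourier1 g xi : cL1 g -> re (fourier1 g) xi = k * (C (re g) xi + S (im g) xi).
Proof. by move=> hg; rewrite /re fourier1E. Qed.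

Lemma im_fourier1 g xi : cL1 g -> im (fourier1 g) xi = k * (C (im g) xi - S (re g) xi).
Proof. by move=> hg; rewrite /im fourier1E. Qed.

Lemma fourier1B g h xi : cL1 g -> cL1 h ->
  fourier1 (g \- h) xi = fourier1 g xi - fourier1 h xi.
Proof.
move=> hg hh; have [g1 g2] := hg; have [h1 h2] := hh.
rewrite !fourier1E //; last exact: cL1B.
have -> : re (g \- h) = (fun x => re g x - re h x) by apply/funext => x; rewrite reB.
have -> : im (g \- h) = (fun x => im g x - im h x) by apply/funext => x; rewrite imB.
rewrite !(kernel_transformB bcos) // !(kernel_transformB bsin) //.
by apply/eqP; rewrite eq_complex /=; apply/andP; split; apply/eqP; ring.
Qed.

Lemma cos_transform_even u xi : C u (- xi) = C u xi :> R.
Proof. by apply: eq_intR => x; rewrite mulNr cosN. Qed.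

Lemma sin_transform_odd u xi : L1 u -> S u (- xi) = - S u xi :> R.
Proof.
move=> hu; rewrite /kernel_transform -intRN; last exact: (L1_kernel bsin).
by apply: eq_intR => x; rewrite mulNr sinN mulrN.
Qed.

(** The squares contribute the energies of the real and imaginary parts. The cross
terms are products of an even cosine transform with an odd sine transform, so they
integrate to 0. *)
Lemma plancherel_complex g : cL1 g -> cL2 g -> cL2 (fourier1 g) /\ sqnorm (fourier1 g) = sqnorm g.
Proof.
move=> hg1 hg2; have [a1 b1] := hg1; have [a2 b2] := hg2.
have [[_ _ ca sa] Ea] := plancherel_real (conj a1 a2).
have [[_ _ cb sb] Eb] := plancherel_real (conj b1 b2).
have hF : cL2 (fourier1 g).
  split.
    by apply: L2_ext (L2Z k (L2D ca sb)) => x; rewrite re_fourier1.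
  by apply: L2_ext (L2Z k (L2B cb sa)) => x; rewrite im_fourier1.
split => //; rewrite !sqnorm_split //.
have p0 : 0 < 2 * pi :> R by rewrite mulr_gt0 // pi_gt0.
have kk : k ^+ 2 = (2 * pi)^-1 by rewrite exprVn sqr_sqrtr // ltW.
have e1 : intR (fun x => re (fourier1 g) x ^+ 2) = k ^+ 2 *
    (intR (fun x => C (re g) x ^+ 2) + intR (fun x => S (im g) x ^+ 2) +
     2 * intR (fun x => C (re g) x * S (im g) x)).
  rewrite -(intRD (L2_sq ca) (L2_sq sb)) -(intRZ 2 (L2M ca sb)).
  rewrite -(intRD (L1D (L2_sq ca) (L2_sq sb)) (L1Z 2 (L2M ca sb))) -intRZ; last first.
    by apply: L1D; [exact: (L1D (L2_sq ca) (L2_sq sb))|exact: (L1Z 2 (L2M ca sb))].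
  by apply: eq_intR => x; rewrite re_fourier1 //; ring.
have e2 : intR (fun x => im (fourier1 g) x ^+ 2) = k ^+ 2 *
    (intR (fun x => C (im g) x ^+ 2) + intR (fun x => S (re g) x ^+ 2) -
     2 * intR (fun x => C (im g) x * S (re g) x)).
  rewrite -(intRD (L2_sq cb) (L2_sq sa)) -(intRZ 2 (L2M cb sa)).
  rewrite -(intRB (L1D (L2_sq cb) (L2_sq sa)) (L1Z 2 (L2M cb sa))) -intRZ; last first.
    by apply: L1B; [exact: (L1D (L2_sq cb) (L2_sq sa))|exact: (L1Z 2 (L2M cb sa))].
  by apply: eq_intR => x; rewrite im_fourier1 //; ring.
have o1 : intR (fun x => C (re g) x * S (im g) x) = 0.
  by apply: (intR_odd (L2M ca sb)) => x; rewrite cos_transform_even sin_transform_odd // mulrN.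
have o2 : intR (fun x => C (im g) x * S (re g) x) = 0.
  by apply: (intR_odd (L2M cb sa)) => x; rewrite cos_transform_even sin_transform_odd // mulrN.
rewrite e1 e2 o1 o2 kk; move: Ea Eb; rewrite /spectral_energy.
move: (intR _) (intR (fun x => S (re g) x ^+ 2)) (intR (fun x => re g x ^+ 2))
  (intR (fun x => C (im g) x ^+ 2)) (intR (fun x => S (im g) x ^+ 2))
  (intR (fun x => im g x ^+ 2)) => x1 x2 x3 x4 x5 x6 h1 h2.
have -> : (2 * pi)^-1 * (x1 + x5 + 2 * 0) + (2 * pi)^-1 * (x4 + x2 - 2 * 0) =
  (2 * pi)^-1 * ((x1 + x2) + (x4 + x5)) by ring.
rewrite h1 h2 -mulrDr mulKf //; exact: lt0r_neq0.
Qed.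

End plancherel_complex.

(** * Completeness of L2 on the line *)

Section completeness.
Context {R : realType}.
Local Notation mu := (@lebesgue_measure R).
Implicit Types (a b : nat -> R -> R).

Lemma sum_exp_half_le2 (k : nat) : \sum_(n < k) (2 ^- n : R) <= 2.
Proof.
suff -> : \sum_(n < k) (2 ^- n : R) = 2 - 2 * 2 ^- k.
  by rewrite lerBlDr lerDl mulr_ge0 // invr_ge0 exprn_ge0.
elim: k => [|k ih]; first by rewrite big_ord0 expr0 invr1; ring.
rewrite big_ord_recr /= ih exprS invfM.
have : (2 : R) * (2^-1 * 2 ^- k) = 2 ^- k by rewrite mulVKf.
by move=> ->; ring.
Qed.

Lemma L1_sum (k : nat) (f : nat -> R -> R) : (forall n, L1 (f n)) ->
  L1 (fun x => \sum_(n < k) f n x) /\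
  intR (fun x => \sum_(n < k) f n x) = \sum_(n < k) intR (f n).
Proof.
move=> hf; elim: k => [|k [ih1 ih2]].
  have e : (fun=> 0 : R) =1 (fun x => \sum_(n < 0) f n x).
    by move=> x; rewrite big_ord0.
  by split; [apply: (L1_ext e); exact: L1_0|rewrite -(eq_intR e) intR0 big_ord0].
have e : (fun x => \sum_(n < k) f n x + f k x) =1 (fun x => \sum_(n < k.+1) f n x).
  by move=> x; rewrite big_ord_recr.
split; first by apply: (L1_ext e); exact: L1D.
by rewrite -(eq_intR e) intRD // ih2 big_ord_recr.
Qed.

(** Monotone sequences converge to their supremum, which has a finite integral by
Fatou's lemma and so is finite almost everywhere. *)
Lemma ae_bounded_of_I_bounded (G : nat -> R -> R) (M : R) :
  (forall k, L1 (G k)) -> (forall k x, 0 <= G k x) ->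
  (forall k x, G k x <= G k.+1 x) -> (forall k, intR (G k) <= M) ->
  {ae mu, forall x, exists B : R, forall k, G k x <= B}.
Proof.
move=> hG G0 nd GM.
pose T x := limn_einf (fun k => (G k x)%:E).
have TE x : T x = ereal_sup (range (fun k => (G k x)%:E)).
  have nd' : nondecreasing_seq (fun k => (G k x)%:E).
    by apply/nondecreasing_seqP => k; rewrite lee_fin.
  rewrite /T is_cvg_limn_einfE; last exact: ereal_nondecreasing_is_cvgn.
  by apply/cvg_lim => //; exact: ereal_nondecreasing_cvgn.
have T0 x : (0 <= T x)%E.
  rewrite TE; apply: (@le_trans _ _ (G 0%N x)%:E); first by rewrite lee_fin.
  by apply: ereal_sup_ubound; exists 0%N.
have h : (\int[mu]_x T x <= M%:E)%E by exact: fatou_limn_einf.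
have mT : measurable_fun setT T.
  by apply: measurable_limn_einf => n; exact: measurable_L1.
have iT : mu.-integrable setT T.
  apply/integrableP; split => //.
  under eq_integral do rewrite gee0_abs //.
  exact: le_lt_trans h (ltry _).
have := integrable_ae measurableT iT; apply: aeS => x /(_ I) fT.
exists (fine (T x)) => k; rewrite -lee_fin fineK // TE.
by apply: ereal_sup_ubound; exists k.
Qed.

(** Bounds the increments d n by 2 ^ n * d n ^ 2 + 2 ^ (- n), so that a bound on the
weighted squares makes the series of increments absolutely convergent. *)
Lemma cvg_of_weighted_sq (s : nat -> R) (B : R) :
  (forall k, \sum_(n < k) 2 ^+ n * (s n.+1 - s n) ^+ 2 <= B) -> cvgn s.
Proof.
move=> hB; pose d n := s n.+1 - s n.
have hd k : \sum_(n < k) `|d n| <= B + 2.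
  apply: (@le_trans _ _ (\sum_(n < k) (2 ^+ n * d n ^+ 2 + 2 ^- n))).
    apply: ler_sum => n _.
    have p0 : 0 < (2 : R) ^+ n by rewrite exprn_gt0.
    rewrite -[X in _ <= X + _](_ : 2 ^+ n * `|d n| ^+ 2 = _); last first.
      by rewrite real_normK ?num_real.
    have [h|h] := leP (2 ^- n) `|d n|.
      have : 1 <= 2 ^+ n * `|d n| by rewrite mulrC -ler_pdivrMr // div1r.
      have q0 : 0 <= 2 ^- n :> R by rewrite invr_ge0 ltW.
      have := normr_ge0 (d n); rewrite expr2; nra.
    apply: (le_trans (ltW h)); rewrite lerDr mulr_ge0 ?sqr_ge0 // ltW //.
  by rewrite big_split /=; apply: lerD; [exact: hB|exact: sum_exp_half_le2].
have cn : cvgn [normed series d].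
  have -> : [normed series d] = (fun n => \sum_(i < n) `|d i|).
    by apply/funext => n; rewrite /= /series /= big_mkord.
  apply: nondecreasing_is_cvgn.
    by apply/nondecreasing_seqP => n; rewrite big_ord_recr /= lerDl.
  by exists (B + 2) => _ [n _ <-]; exact: hd.
have := normed_cvg cn => cd.
have e n : s n = s 0%N + series d n.
  rewrite /series /=; have := telescope_sumr s (leq0n n).
  by rewrite /d => ->; ring.
have -> : s = (fun n => s 0%N + series d n) by apply/funext.
by apply: is_cvgD => //; exact: is_cvg_cst.
Qed.

(** A subsequence whose successive differences have square norm at most 4 ^ (- n)
converges almost everywhere: the sum of the 2 ^ n * d n ^ 2 has bounded integral.
Fatou's lemma then compares the limit with every term of the original sequence. *)
Lemma L2_complete a : (forall n, L2 (a n)) ->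
  (forall e : R, 0 < e -> exists M, forall m n, (M <= m)%N -> (M <= n)%N ->
     intR (fun x => (a m x - a n x) ^+ 2) <= e) ->
  exists2 f, L2 f & forall e : R, 0 < e -> exists M, forall m, (M <= m)%N ->
     intR (fun x => (f x - a m x) ^+ 2) <= e.
Proof.
move=> ha cau.
have p4 n : 0 < (4 : R) ^- n by rewrite invr_gt0 exprn_gt0.
pose Mn n := projT1 (cid (cau _ (p4 n))).
have MnP n := projT2 (cid (cau _ (p4 n))).
(* A monotone choice of indices with phi n >= Mn n, so that phi n and phi n.+1 are
   both beyond the rank of the bound 4 ^- n. *)
pose phi n := (n + \sum_(j < n.+1) Mn j)%N.
have phiM n : (Mn n <= phi n)%N by rewrite /phi big_ord_recr /= addnA leq_addl.
have phiS n : (phi n <= phi n.+1)%N.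
  by rewrite /phi [in leqRHS]big_ord_recr /=; apply: leq_add => //; exact: leq_addr.
have phin n : (n <= phi n)%N by rewrite leq_addr.
pose d n x := a (phi n.+1) x - a (phi n) x.
have hd n : L2 (d n) by exact: L2B.
have Id n : intR (fun x => d n x ^+ 2) <= 4 ^- n.
  by apply: MnP; [exact: leq_trans (phiM n) (phiS n)|exact: phiM].
pose f n x := 2 ^+ n * d n x ^+ 2.
have hf n : L1 (f n) by apply: L1Z; exact: L2_sq.
pose G k x := \sum_(n < k) f n x.
have aeB : {ae mu, forall x, exists B : R, forall k, G k x <= B}.
  apply: (@ae_bounded_of_I_bounded _ 2).
  - by move=> k; have [] := L1_sum k hf.
  - by move=> k x; apply: sumr_ge0 => n _; rewrite mulr_ge0 ?sqr_ge0 ?exprn_ge0.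
  - move=> k x; rewrite /G big_ord_recr /= lerDl.
    by rewrite mulr_ge0 ?sqr_ge0 ?exprn_ge0.
  - move=> k; have [_ ->] := L1_sum k hf; apply: le_trans (sum_exp_half_le2 k).
    apply: ler_sum => n _; rewrite /f intRZ; last exact: L2_sq.
    apply: (@le_trans _ _ (2 ^+ n * 4 ^- n)).
      by rewrite ler_pM2l ?exprn_gt0.
    have -> : (4 : R) = 2 * 2 by ring.
    by rewrite exprMn invfM mulVKf // expf_neq0.
have [Z [mZ Z0 ZP]] := aeB.
(* Killing the exceptional null set makes the subsequence converge everywhere, so
   that its limit is measurable. *)
pose b n x := \1_(~` Z) x * a (phi n) x.
have cvb x : cvgn (b ^~ x).
  rewrite /b indicE; have [xZ|xZ] := boolP (x \in ~` Z).
    have [B hB] : exists B : R, forall k, G k x <= B.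
      by apply: contrapT => h; move: xZ; rewrite inE /=; apply; exact: ZP.
    under eq_fun do rewrite mul1r.
    exact: (cvg_of_weighted_sq hB).
  under eq_fun do rewrite mul0r.
  exact: is_cvg_cst.
pose F x := lim (b ^~ x @ \oo).
have bF x : b n x @[n --> \oo] --> F x by exact: cvb.
have mb n : measurable_fun setT (b n).
  apply: measurable_funM; last by case: (ha (phi n)).
  by apply: measurable_indic; exact: measurableC.
have mF : measurable_fun setT F by exact: (measurable_fun_cvg mb (fun x _ => bF x)).
have aZ : {ae mu, forall x, x \notin Z}.
  exists Z; split => // x /= /negP; rewrite negbK inE //.
have key m (e : R) (M : nat) : (forall n, (M <= n)%N ->
    intR (fun x => (a n x - a m x) ^+ 2) <= e) ->
  L2 (fun x => F x - a m x) /\ intR (fun x => (F x - a m x) ^+ 2) <= e.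
  move=> hM.
  have mFm : measurable_fun setT (fun x => F x - a m x).
    by apply: measurable_funB => //; case: (ha m).
  have cv : {ae mu, forall x,
      (a (phi (n + M)) x - a m x) ^+ 2 @[n --> \oo] --> (F x - a m x) ^+ 2}.
    apply: aeS aZ => x xZ.
    have be n : b n x = a (phi n) x.
      by rewrite /b indicE in_setC xZ mul1r.
    have c0 : a (phi (n + M)) x @[n --> \oo] --> F x.
      rewrite (_ : (fun n => a (phi (n + M)) x) = (fun n => b (n + M) x)).
        by move: (bF x); rewrite -(cvg_shiftn M).
      by apply/funext => n; rewrite be.
    have c1 : a (phi (n + M)) x - a m x @[n --> \oo] --> F x - a m x.
      by apply: cvgB => //; exact: cvg_cst.
    by under eq_fun do rewrite expr2; rewrite expr2; exact: cvgM.
  have [h1 h2] := @fatou_intR R (fun n x => (a (phi (n + M)) x - a m x) ^+ 2)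
    (fun x => (F x - a m x) ^+ 2) e
    (fun n => L2_sq (L2B (ha _) (ha m))) (fun n x => sqr_ge0 _)
    (fun n => hM _ (leq_trans (leq_addl _ _) (phin _))) (measurable_funX _ mFm)
    cv (fun x => sqr_ge0 _).
  by [].
have F_L2 : L2 F.
  have [M0 hM0] := cau 1 ltr01.
  have [h _] := key M0 1 M0 (fun n hn => hM0 n M0 hn (leqnn _)).
  by apply: L2_ext (L2D h (ha M0)) => x; rewrite subrK.
exists F => // e e0; have [M hM] := cau e e0; exists M => m Mm.
by have [_] := key m e M (fun n hn => hM n m hn Mm).
Qed.

End completeness.

(** * Convergence in L2 of complex functions *)

Section fourier_relation.
Context {R : realType}.
Local Notation mu := (@lebesgue_measure R).
Local Notation C := (kernel_transform cos).
Local Notation S := (kernel_transform sin).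
Local Notation bcos := bounded_kernel_cos.
Local Notation bsin := bounded_kernel_sin.
Implicit Types (g h G H : R -> R[i]) (z w : R[i]) (u v : nat -> R -> R[i]).

(** Stated with square norms, which are real numbers, to avoid square roots and
extended reals; [cvgL2P] relates it to convergence of the norms. *)
Definition cvgL2 u g := forall e : R, 0 < e -> exists M, forall n, (M <= n)%N ->
  sqnorm (u n \- g) <= e.

Lemma cvgL2P u g : (forall n, cL2 (u n)) -> cL2 g ->
  ((fun n => Lpnorm 2 (u n \- g)) @ \oo --> 0%E) <-> cvgL2 u g.
Proof.
move=> hu hg.
have -> : (fun n => Lpnorm 2 (u n \- g)) = (fun n => (Num.sqrt (sqnorm (u n \- g)))%:E).
  by apply/funext => n; rewrite Lpnorm2_sqnorm //; exact: cL2B.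
split=> h.
  move/fine_cvgP : h => [_ /cvgrPdist_le h] e e0.
  have s0 : 0 < Num.sqrt e by rewrite sqrtr_gt0.
  have [M _ hM] := h _ s0.
  exists M => n Mn; have := hM n Mn; rewrite /= sub0r normrN ger0_norm ?sqrtr_ge0 //.
  by rewrite ler_sqrt // ltW.
apply/fine_cvgP; split; first exact: nearW.
apply/cvgrPdist_le => e e0; have [M hM] := h (e ^+ 2) (exprn_gt0 2 e0).
exists M => // n Mn; rewrite /= sub0r normrN ger0_norm ?sqrtr_ge0 //.
by rewrite -[leRHS](gtr0_norm e0) -sqrtr_sqr; apply: ler_wsqrtr; exact: hM.
Qed.

(** Turns two inequalities of the form of [sqmod_le_near] into an estimate of the
difference of the square norms. *)
Lemma dist_le_of_sandwich (a b c t e : R) : 0 <= a -> 0 < t -> t <= 1 ->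
  t * (2 * a + 4) <= e -> 0 <= b -> b <= (1 + t) * a + c -> a <= (1 + t) * b + c ->
  c <= t ^+ 2 + t -> `|a - b| <= e.
Proof.
move=> a0 t0 t1 te b0 h1 h2 hc.
have tt : t ^+ 2 <= t by rewrite expr2 ler_piMl // ltW.
have ta : t * a <= a by rewrite ler_piMl.
have ta0 : 0 <= t * a by rewrite mulr_ge0 // ltW.
have b1 : b <= 2 * a + 2 by lra.
have tb : t * b <= t * (2 * a + 2) by rewrite ler_pM2l.
by rewrite ler_norml; apply/andP; split; lra.
Qed.

Lemma cvgL2_sqnorm u g : (forall n, cL2 (u n)) -> cL2 g -> cvgL2 u g ->
  sqnorm (u n) @[n --> \oo] --> sqnorm g.
Proof.
move=> hu hg ug; apply/cvgrPdist_le => e e0.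
have N0 := sqnorm_ge0 g.
have d0 : 0 < 2 * sqnorm g + 4 by rewrite ltr_wpDl // mulr_ge0.
pose t := Num.min 1 (e / (2 * sqnorm g + 4)).
have t0 : 0 < t by rewrite lt_min ltr01 divr_gt0.
have t1 : t <= 1 by rewrite ge_min lexx.
have te : t * (2 * sqnorm g + 4) <= e by rewrite -ler_pdivlMr // ge_min lexx orbT.
have [M hM] := ug (t ^+ 2) (exprn_gt0 2 t0).
exists M => // n Mn /=; have d := hM n Mn.
have h1 := sqnorm_le_near t0 hg (hu n); rewrite sqnormBC in h1.
have h2 := sqnorm_le_near t0 (hu n) hg.
have k : (1 + t^-1) * sqnorm (u n \- g) <= t ^+ 2 + t.
  have -> : t ^+ 2 + t = (1 + t^-1) * t ^+ 2 by field; exact: lt0r_neq0.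
  by apply: ler_wpM2l => //; rewrite addr_ge0 // invr_ge0 ltW.
have Nu := sqnorm_ge0 (u n).
exact: (dist_le_of_sandwich N0 t0 t1 te Nu h1 h2 k).
Qed.

Lemma cvgL2B u v g h : (forall n, cL2 (u n)) -> (forall n, cL2 (v n)) ->
  cL2 g -> cL2 h -> cvgL2 u g -> cvgL2 v h ->
  cvgL2 (fun n => u n \- v n) (g \- h).
Proof.
move=> hu hv hg hh ug vh e e0.
have e4 : 0 < e / 4 by rewrite divr_gt0.
have [M1 h1] := ug _ e4; have [M2 h2] := vh _ e4.
exists (maxn M1 M2) => n; rewrite geq_max => /andP[k1 k2].
have := sqnormB_triangle (cL2B (hu n) (hv n)) (cL2B hg (hv n)) (cL2B hg hh).
have -> : sqnorm ((u n \- v n) \- (g \- v n)) = sqnorm (u n \- g).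
  by apply: eq_intR => x /=; congr sqmod; ring.
have -> : sqnorm ((g \- v n) \- (g \- h)) = sqnorm (h \- v n).
  by apply: eq_intR => x /=; congr sqmod; ring.
rewrite (sqnormBC h).
by have := h1 n k1; have := h2 n k2; lra.
Qed.

Lemma cL2_complete u : (forall n, cL2 (u n)) ->
  (forall e : R, 0 < e -> exists M, forall m n, (M <= m)%N -> (M <= n)%N ->
     sqnorm (u m \- u n) <= e) ->
  exists2 g, cL2 g & cvgL2 u g.
Proof.
move=> hu cau.
have sp m n : intR (fun x => (re (u m) x - re (u n) x) ^+ 2) +
    intR (fun x => (im (u m) x - im (u n) x) ^+ 2) = sqnorm (u m \- u n).
  rewrite sqnorm_split; last exact: cL2B.
  by congr (_ + _); apply: eq_intR => x; rewrite ?reB ?imB.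
have [||f1 hf1 cf1] := @L2_complete R (fun n => re (u n)).
- by move=> n; case: (hu n).
- move=> e e0; have [M hM] := cau e e0; exists M => m n Mm Mn.
  apply: le_trans (hM m n Mm Mn); rewrite -sp lerDl.
  by apply: intR_ge0 => x; exact: sqr_ge0.
have [||f2 hf2 cf2] := @L2_complete R (fun n => im (u n)).
- by move=> n; case: (hu n).
- move=> e e0; have [M hM] := cau e e0; exists M => m n Mm Mn.
  apply: le_trans (hM m n Mm Mn); rewrite -sp lerDr.
  by apply: intR_ge0 => x; exact: sqr_ge0.
have hg : cL2 (fun x => f1 x +i* f2 x) by [].
exists (fun x => f1 x +i* f2 x) => // e e0.
have e2 : 0 < e / 2 by rewrite divr_gt0.
have [M1 h1] := cf1 _ e2; have [M2 h2] := cf2 _ e2.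
exists (maxn M1 M2) => n; rewrite geq_max => /andP[k1 k2].
rewrite sqnormBC sqnorm_split; last exact: cL2B.
have := h1 n k1; have := h2 n k2.
rewrite (eq_intR (v := fun x => im ((fun x => f1 x +i* f2 x) \- u n) x ^+ 2)); last first.
  by move=> x; rewrite imB.
rewrite (eq_intR (u := fun x => (f1 x - _) ^+ 2)
  (v := fun x => re ((fun x => f1 x +i* f2 x) \- u n) x ^+ 2)); last first.
  by move=> x; rewrite reB.
by lra.
Qed.


End fourier_relation.

(** * The Fourier transform on L2 is a surjective isometry *)

Section fourier_on_L2.
Context {R : realType}.
Local Notation mu := (@lebesgue_measure R).
Local Notation C := (kernel_transform cos).
Local Notation S := (kernel_transform sin).
Local Notation bcos := bounded_kernel_cos.
Local Notation bsin := bounded_kernel_sin.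
Local Notation k := ((Num.sqrt (2 * pi))^-1 : R).
Implicit Types (g h G H : R -> R[i]) (z w : R[i]) (u v : nat -> R -> R[i]).

(** The relation [is_fourier] with square-integrability and convergence in the real-
valued form used here. *)
Definition fourier_rel g G := [/\ cL2 g, cL2 G &
  exists u, [/\ forall n, cL1 (u n), forall n, cL2 (u n),
    cvgL2 u g & cvgL2 (fun n => fourier1 (u n)) G]].

Lemma is_fourierP g G : is_fourier g G <-> fourier_rel g G.
Proof.
split=> [[/Lpfun2P hg /Lpfun2P hG [u [hu ug uG]]]|[hg hG [u [h1 h2 ug uG]]]].
  have h1 n : cL1 (u n) by have [/Lpfun1P] := hu n.
  have h2 n : cL2 (u n) by have [_ /Lpfun2P] := hu n.
  have hF n : cL2 (fourier1 (u n)) by have [] := plancherel_complex (h1 n) (h2 n).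
  split => //; exists u; split => //; exact/cvgL2P.
have hF n : cL2 (fourier1 (u n)) by have [] := plancherel_complex (h1 n) (h2 n).
split; [exact/Lpfun2P|exact/Lpfun2P|exists u; split].
- by move=> n; split; [exact/Lpfun1P|exact/Lpfun2P].
- by apply/cvgL2P.
- by apply/(cvgL2P hF hG).
Qed.

(** Both square norms are limits of the same sequence, by Plancherel's identity on
the intersection of L1 and L2. *)
Lemma fourier_rel_sqnorm g G : fourier_rel g G -> sqnorm G = sqnorm g.
Proof.
move=> [hg hG [u [h1 h2 ug uG]]].
have hF n : cL2 (fourier1 (u n)) by have [] := plancherel_complex (h1 n) (h2 n).
have c1 := cvgL2_sqnorm h2 hg ug; have := cvgL2_sqnorm hF hG uG.
have -> : (fun n => sqnorm (fourier1 (u n))) = (fun n => sqnorm (u n)).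
  by apply/funext => n; have [] := plancherel_complex (h1 n) (h2 n).
by move=> c2; exact: (cvg_unique _ c2 c1).
Qed.

Lemma fourier_relB g G h H : fourier_rel g G -> fourier_rel h H ->
  fourier_rel (g \- h) (G \- H).
Proof.
move=> [hg hG [u [h1 h2 ug uG]]] [hh hH [v [k1 k2 vh vH]]].
have hFu n : cL2 (fourier1 (u n)) by have [] := plancherel_complex (h1 n) (h2 n).
have hFv n : cL2 (fourier1 (v n)) by have [] := plancherel_complex (k1 n) (k2 n).
split; [exact: cL2B|exact: cL2B|exists (fun n => u n \- v n); split].
- by move=> n; exact: cL1B.
- by move=> n; exact: cL2B.
- exact: cvgL2B.
- have -> : (fun n => fourier1 (u n \- v n)) = (fun n => fourier1 (u n) \- fourier1 (v n)).
    by apply/funext => n; apply/funext => x; rewrite fourier1B.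
  exact: cvgL2B.
Qed.

Lemma sqnormBB g : sqnorm (g \- g) = 0.
Proof.
rewrite -[RHS](@intR0 R); apply: eq_intR => x; by rewrite /= subrr /sqmod /= expr0n addr0.
Qed.

Lemma fourier_rel_uniq g G G' : fourier_rel g G -> fourier_rel g G' -> sqnorm (G \- G') = 0.
Proof.
by move=> h h'; rewrite (fourier_rel_sqnorm (fourier_relB h h')) sqnormBB.
Qed.

Lemma fourier_rel_ae g G G' : fourier_rel g G -> cL2 G' -> sqnorm (G \- G') = 0 ->
  fourier_rel g G'.
Proof.
move=> [hg hG [u [h1 h2 ug uG]]] hG' e; split => //; exists u; split => //.
have hF n : cL2 (fourier1 (u n)) by have [] := plancherel_complex (h1 n) (h2 n).
move=> d d0; have [M hM] := uG _ (divr_gt0 d0 (ltr0n R 2)).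
exists M => n Mn; apply: le_trans (sqnormB_triangle (hF n) hG hG') _.
by rewrite e; have := hM n Mn; lra.
Qed.

(** Cutting to ]- n, n] gives functions that are integrable, by the Cauchy-Schwarz
inequality against the indicator. *)
Lemma truncation_cvgL2 g : cL2 g -> exists u, [/\ forall n, cL1 (u n), forall n, cL2 (u n) &
  cvgL2 u g].
Proof.
move=> hg; have [[m1 g1] [m2 g2]] := hg.
pose J n := itv_indic (- n%:R) n%:R : R -> R.
have J01 n x : J n x = 0 \/ J n x = 1.
  by rewrite /J /itv_indic indicE; case: (_ \in _); [right|left].
pose u n x : R[i] := (J n x * complex.Re (g x)) +i* (J n x * complex.Im (g x)).
have h1 n : cL1 (u n).
  split; exact: (L2M (L2_itv_indic _ _)).
have h2 n : cL2 (u n).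
  apply: (@cL2_le _ (u n) _ _ (L1_sqmod hg)).
    by split; apply: measurable_funM => //; exact: measurable_itv_indic.
  move=> x; rewrite /u /sqmod /=; have := sqr_ge0 (complex.Re (g x)).
  have := sqr_ge0 (complex.Im (g x)).
  by have [->|->] := J01 n x; rewrite ?mul0r ?mul1r ?expr0n /=; lra.
exists u; split => // e e0.
suff [_] : L1 (fun=> 0 : R) /\ (sqnorm (u n \- g) @[n --> \oo] --> intR (fun=> 0 : R)).
  rewrite intR0 => /cvgrPdist_le/(_ _ e0)[M _ hM]; exists M => n Mn.
  by have := hM n Mn; rewrite sub0r normrN; apply: le_trans; exact: ler_norm.
apply: (@dominated_cvg_intR R (fun n x => sqmod ((u n \- g) x)) (fun=> 0) _ _ (L1_sqmod hg)).
- by move=> n; apply: measurable_sqmod; apply: cL2_meas; exact: cL2B.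
- move=> n x; rewrite ger0_norm ?sqmod_ge0 //= /u; case: (g x) => a b.
  rewrite /sqmod /=; have := sqr_ge0 a; have := sqr_ge0 b.
  have [->|->] := J01 n x; rewrite ?mul0r ?mul1r ?sub0r ?subrr ?sqrrN ?expr0n /=; lra.
- move=> x; apply: cvg_near_cst; exists (Num.truncn `|x|).+1 => // n /= xn.
  have h : `|x| < n%:R by rewrite (lt_le_trans (truncnS_gt _)) // ler_nat.
  have J1 : J n x = 1.
    rewrite /J /itv_indic indicE mem_set //= in_itv /=.
    by move: h; rewrite ltr_norml => /andP[-> /ltW ->].
  rewrite /u J1 !mul1r; case: (g x) => a b.
  by rewrite /sqmod /= !subrr expr0n addr0.
Qed.

(** The transforms of the truncations form a Cauchy sequence, being at the same
distances as the truncations. *)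
Lemma fourier_rel_ex g : cL2 g -> exists G, fourier_rel g G.
Proof.
move=> hg; have [u [h1 h2 ug]] := truncation_cvgL2 hg.
have hF n : cL2 (fourier1 (u n)) by have [] := plancherel_complex (h1 n) (h2 n).
have [|G hG uG] := cL2_complete hF; last by exists G; split => //; exists u.
move=> e e0; have [M hM] := ug _ (divr_gt0 e0 (ltr0n R 4)).
exists M => m n Mm Mn.
have -> : sqnorm (fourier1 (u m) \- fourier1 (u n)) = sqnorm (u m \- u n).
  have [_ <-] := plancherel_complex (cL1B (h1 m) (h1 n)) (cL2B (h2 m) (h2 n)).
  by congr sqnorm; apply/funext => x; rewrite fourier1B.
apply: le_trans (sqnormB_triangle (h2 m) hg (h2 n)) _; rewrite (sqnormBC g).
by have := hM m Mm; have := hM n Mn; lra.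
Qed.

Definition conjf g : R -> R[i] := fun x => complex.Re (g x) +i* - complex.Im (g x).
(** The real part of the integral of g h, without conjugation. Real values are enough
to recover the norm of a difference, see [sqnormB_pairing]. *)
Definition pairing g h : R := intR (fun x => re g x * re h x - im g x * im h x).

Lemma conjfK g : conjf (conjf g) = g.
Proof. by apply/funext => x; rewrite /conjf /= opprK; case: (g x). Qed.

Lemma cL2_conjf g : cL2 g -> cL2 (conjf g).
Proof. by move=> [h1 h2]; split => //; exact: (L2N h2). Qed.

Lemma sqnorm_conjf g : sqnorm (conjf g) = sqnorm g.
Proof. by apply: eq_intR => x; rewrite /sqmod /= sqrrN. Qed.

Lemma L1_pairing g h : cL2 g -> cL2 h -> L1 (fun x => re g x * re h x - im g x * im h x).
Proof. by move=> [g1 g2] [h1 h2]; apply: L1B; exact: L2M. Qed.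

Lemma sqnormB_pairing g h : cL2 g -> cL2 h -> sqnorm (g \- h) = sqnorm g + sqnorm h - 2 * pairing g (conjf h).
Proof.
move=> hg hh; rewrite /sqnorm /pairing.
have hp := L1_pairing hg (cL2_conjf hh).
rewrite -(intRD (L1_sqmod hg) (L1_sqmod hh)) -(intRZ 2 hp).
rewrite -(intRB (L1D (L1_sqmod hg) (L1_sqmod hh)) (L1Z 2 hp)).
apply: eq_intR => x; rewrite /re /im /conjf /=; case: (g x) => a b; case: (h x) => c d.
by rewrite /sqmod /=; ring.
Qed.

(** Expresses the pairing by norms alone, so that its continuity follows from that of
the norm. *)
Lemma pairing_polarization g h : cL2 g -> cL2 h -> pairing g h = (sqnorm g + sqnorm h - sqnorm (g \- conjf h)) / 2.
Proof.
by move=> hg hh; rewrite sqnormB_pairing ?conjfK ?sqnorm_conjf //; [field|exact: cL2_conjf].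
Qed.

Lemma pairing_cvg u v g h : (forall n, cL2 (u n)) -> (forall n, cL2 (v n)) ->
  cL2 g -> cL2 h -> cvgL2 u g -> cvgL2 v h ->
  pairing (u n) (v n) @[n --> \oo] --> pairing g h.
Proof.
move=> hu hv hg hh ug vh; rewrite pairing_polarization //.
have -> : (fun n => pairing (u n) (v n)) =
    (fun n => (sqnorm (u n) + sqnorm (v n) - sqnorm (u n \- conjf (v n))) / 2).
  by apply/funext => n; rewrite pairing_polarization.
have vh' : cvgL2 (fun n => conjf (v n)) (conjf h).
  move=> e e0; have [M hM] := vh e e0; exists M => n Mn.
  rewrite (_ : sqnorm _ = sqnorm (v n \- h)); first exact: hM.
  rewrite -sqnorm_conjf; congr sqnorm; apply/funext => x; rewrite /conjf /=.
  by case: (v n x) => a b; case: (h x) => c d /=; congr (_ +i* _); ring.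
apply: cvgM; last exact: cvg_cst.
apply: cvgB.
  by apply: cvgD; apply: cvgL2_sqnorm.
apply: (@cvgL2_sqnorm _ (fun n => u n \- conjf (v n))).
- by move=> n; apply: cL2B => //; exact: cL2_conjf.
- by apply: cL2B => //; exact: cL2_conjf.
- by apply: cvgL2B => //; [move=> n|]; exact: cL2_conjf.
Qed.

(** The symmetry of the cosine and sine transforms, term by term. *)
Lemma pairing_fourier1 g h : cL1 g -> cL1 h -> pairing (fourier1 g) h = pairing g (fourier1 h).
Proof.
move=> hg hh; have [g1 g2] := hg; have [h1 h2] := hh.
have L (phi a b : R -> R) : bounded_kernel phi -> L1 a -> L1 b ->
  L1 (fun x => a x * kernel_transform phi b x).
  by move=> bp ha hb; apply: L1_ext (L1_kernel_transformM bp hb ha) => x; rewrite mulrC.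
rewrite /pairing.
transitivity (k * (intR (fun x => C (re g) x * re h x) + intR (fun x => S (im g) x * re h x)
  - (intR (fun x => C (im g) x * im h x) - intR (fun x => S (re g) x * im h x)))).
  rewrite -(intRD (L1_kernel_transformM bcos g1 h1) (L1_kernel_transformM bsin g2 h1)).
  rewrite -(intRB (L1_kernel_transformM bcos g2 h2) (L1_kernel_transformM bsin g1 h2)).
  have p1 := L1D (L1_kernel_transformM bcos g1 h1) (L1_kernel_transformM bsin g2 h1).
  have p2 := L1B (L1_kernel_transformM bcos g2 h2) (L1_kernel_transformM bsin g1 h2).
  rewrite -(intRB p1 p2) -(intRZ _ (L1B p1 p2)); apply: eq_intR => x.
  by rewrite re_fourier1 // im_fourier1 //; ring.
rewrite (kernel_transform_sym bcos g1 h1) (kernel_transform_sym bsin g2 h1) (kernel_transform_sym bcos g2 h2) (kernel_transform_sym bsin g1 h2).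
have q1 := L _ _ _ bcos g1 h1; have q2 := L _ _ _ bsin g2 h1.
have q3 := L _ _ _ bcos g2 h2; have q4 := L _ _ _ bsin g1 h2.
rewrite -(intRD q1 q2) -(intRB q3 q4) -(intRB (L1D q1 q2) (L1B q3 q4)).
rewrite -(intRZ _ (L1B (L1D q1 q2) (L1B q3 q4))); apply: eq_intR => x.
by rewrite re_fourier1 // im_fourier1 //; ring.
Qed.

Lemma pairing_fourier_rel g G h H : fourier_rel g G -> fourier_rel h H ->
  pairing G h = pairing g H.
Proof.
move=> [hg hG [u [h1 h2 ug uG]]] [hh hH [v [k1 k2 vh vH]]].
have hFu n : cL2 (fourier1 (u n)) by have [] := plancherel_complex (h1 n) (h2 n).
have hFv n : cL2 (fourier1 (v n)) by have [] := plancherel_complex (k1 n) (k2 n).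
have c1 := pairing_cvg hFu k2 hG hh uG vh; have c2 := pairing_cvg h2 hFv hg hH ug vH.
have e : (fun n => pairing (fourier1 (u n)) (v n)) = (fun n => pairing (u n) (fourier1 (v n))).
  by apply/funext => n; exact: pairing_fourier1.
rewrite e in c1; exact: (cvg_unique _ c1 c2).
Qed.

(** With H the transform of the conjugate of G, the preimage is the conjugate of H.
If G' is its transform, symmetry gives that the pairing of G' with the conjugate of G
is the pairing of conj H with H, the square norm of H; since all the norms agree,
expanding the square norm of G' - G gives 0. *)
Lemma fourier_rel_surj G : cL2 G -> exists g, fourier_rel g G.
Proof.
move=> hG; have [H rH] := fourier_rel_ex (cL2_conjf hG).
have hH : cL2 H by case: rH.
have [G' rG'] := fourier_rel_ex (cL2_conjf hH).
exists (conjf H); apply: (fourier_rel_ae rG') => //.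
have hG' : cL2 G' by case: rG'.
rewrite sqnormB_pairing // (pairing_fourier_rel rG' rH) (fourier_rel_sqnorm rG') sqnorm_conjf.
have -> : pairing (conjf H) H = sqnorm H.
  apply: eq_intR => x; rewrite /re /im /conjf /sqmod /=; case: (H x) => a b /=; ring.
by rewrite (fourier_rel_sqnorm rH) sqnorm_conjf; ring.
Qed.

End fourier_on_L2.

(** * Fourier multipliers and the error estimate *)

Section multipliers.
Context {R : realType}.
Local Notation mu := (@lebesgue_measure R).
Implicit Types (g h sigma : R -> R[i]) (z w : R[i]).

Lemma fourierP g : cL2 g -> fourier_rel g (fourier g).
Proof.
move=> /fourier_rel_ex[G /is_fourierP hG]; apply/is_fourierP.
exact: (@xgetPex _ (fun=> 0) [set G | is_fourier g G] (ex_intro _ G hG)).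
Qed.

Lemma fourier_cL2 g : cL2 g -> cL2 (fourier g).
Proof. by move=> /fourierP[]. Qed.

Lemma sqnorm_fourierB g h : cL2 g -> cL2 h -> sqnorm (fourier g \- fourier h) = sqnorm (g \- h).
Proof. by move=> hg hh; rewrite (fourier_rel_sqnorm (fourier_relB (fourierP hg) (fourierP hh))). Qed.

(** Surjectivity provides a preimage of sigma F g, so that the defining property of
the multiplier can be satisfied and the chosen representative has it. *)
Lemma fourier_multP sigma g : cL2 (fun x => sigma x * fourier g x) ->
  cL2 (fourier_mult sigma g) /\
  {ae mu, forall x, fourier (fourier_mult sigma g) x = sigma x * fourier g x}.
Proof.
move=> hs; have [h rh] := fourier_rel_surj hs.
have hh : cL2 h by case: rh.
have e := sqnormB_eq0_ae (fourier_cL2 hh) hs (fourier_rel_uniq (fourierP hh) rh).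
have [] : [set h | Lpfun 2 h /\
    {ae mu, forall xi, fourier h xi = sigma xi * fourier g xi}] (fourier_mult sigma g).
  by apply: (@xgetPex _ (fun=> 0)); exists h; split => //; exact/Lpfun2P.
by move=> /Lpfun2P.
Qed.

Lemma cmeasurableM g h : cmeasurable g -> cmeasurable h -> cmeasurable (fun x => g x * h x).
Proof.
move=> [g1 g2] [h1 h2]; split.
  have -> : (fun x => complex.Re (g x * h x)) =
      (fun x => complex.Re (g x) * complex.Re (h x) - complex.Im (g x) * complex.Im (h x)).
    by apply/funext => x; case: (g x); case: (h x).
  by apply: measurable_funB; exact: measurable_funM.
have -> : (fun x => complex.Im (g x * h x)) =
    (fun x => complex.Re (g x) * complex.Im (h x) + complex.Im (g x) * complex.Re (h x)).
  by apply/funext => x; case: (g x) => a b; case: (h x) => c d /=; ring.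
by apply: measurable_funD; exact: measurable_funM.
Qed.

Lemma cmeasurable_monomial p : cmeasurable (fun x : R => (0 +i* x) ^+ p).
Proof.
elim: p => [|p ih].
  by split; under eq_fun do rewrite expr0 /=; exact: measurable_cst.
have -> : (fun x : R => (0 +i* x) ^+ p.+1) = (fun x => (0 +i* x) * (0 +i* x) ^+ p).
  by apply/funext => x; rewrite exprS.
apply: cmeasurableM => //; split => /=; [exact: measurable_cst|exact: measurable_id].
Qed.

Lemma sqmod1 : sqmod (1 : R[i]) = 1.
Proof. by rewrite /sqmod /= expr1n expr0n addr0. Qed.

Lemma sqmod_monomial p (x : R) : sqmod ((0 +i* x) ^+ p) = (`|x| ^+ p) ^+ 2.
Proof.
elim: p => [|p ih]; first by rewrite !expr0 expr1n sqmod1.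
rewrite [(_ +i* _) ^+ _]exprS sqmodM ih [`|x| ^+ p.+1]exprS [in RHS]exprMn.
by rewrite [`|x| ^+ 2]real_normK ?num_real // /sqmod /= expr0n add0r.
Qed.

(** The pointwise form of the two admissibility conditions. The second one combines
|x|^p (|x| / r)^(s - p) = r^(p - s) |x|^s with |x|^(2 s) <= (1 + x^2)^s. *)
Lemma monomial_bounds (s : R) (p : nat) (C1 C2 r x : R) (z : R[i]) :
  0 < s -> p%:R < s -> 0 < r -> 0 < C1 -> 0 < C2 ->
  `|x| ^+ p * cnorm z <= C1 * r ^+ p ->
  cnorm (1 - z) <= C2 * Num.min 1 ((`|x| / r) `^ (s - p%:R)) ->
  sqmod ((0 +i* x) ^+ p * z) <= (C1 * r ^+ p) ^+ 2 /\
  sqmod ((0 +i* x) ^+ p * (1 - z)) <=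
    (C2 * r `^ (p%:R - s)) ^+ 2 * (1 + x ^+ 2) `^ s.
Proof.
move=> s0 ps r0 c1 c2 h1 h2.
rewrite !sqmodM !sqmod_monomial -!cnorm_sqr -!exprMn; split.
  by rewrite ler_pXn2r // nnegrE mulr_ge0 ?exprn_ge0 ?cnorm_ge0 // ltW.
have k1 : `|x| ^+ p * cnorm (1 - z) <= C2 * r `^ (p%:R - s) * `|x| `^ s.
  apply: (@le_trans _ _ (`|x| ^+ p * (C2 * (`|x| / r) `^ (s - p%:R)))).
    apply: ler_wpM2l; first exact: exprn_ge0.
    by apply: le_trans h2 _; rewrite ler_pM2l // ge_min lexx orbT.
  rewrite powRM ?invr_ge0 ?(ltW r0) //.
  have -> : r^-1 `^ (s - p%:R) = r `^ (p%:R - s).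
    by rewrite -powR_inv1 ?ltW // -powRrM mulN1r opprB.
  have -> : `|x| `^ s = `|x| ^+ p * `|x| `^ (s - p%:R).
    rewrite -powR_mulrn // -powRD; first by rewrite addrC subrK.
    by rewrite addrC subrK (gt_eqF s0).
  by rewrite le_eqVlt; apply/orP; left; apply/eqP; ring.
apply: (@le_trans _ _ ((C2 * r `^ (p%:R - s) * `|x| `^ s) ^+ 2)).
  rewrite ler_pXn2r // nnegrE ?mulr_ge0 ?exprn_ge0 ?cnorm_ge0 ?powR_ge0 //.
  exact: ltW.
rewrite exprMn ler_wpM2l ?sqr_ge0 //.
rewrite expr2 -powRM // -expr2 real_normK ?num_real //.
by rewrite ge0_ler_powR ?nnegrE ?addr_ge0 ?sqr_ge0 ?lerDr // ltW.
Qed.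

Lemma Hs_weight (s E : R) f : 0 < E -> cL2 f -> (Hsnorm s f <= E%:E)%E ->
  L1 (fun x => (1 + x ^+ 2) `^ s * sqmod (fourier f x)) /\
  intR (fun x => (1 + x ^+ 2) `^ s * sqmod (fourier f x)) <= E ^+ 2.
Proof.
move=> E0 hf; have hF := fourier_cL2 hf.
pose w (x : R) := (1 + x ^+ 2) `^ s * sqmod (fourier f x).
have -> : Hsnorm s f = poweR (\int[mu]_x (w x)%:E) 2^-1.
  by rewrite /Hsnorm; congr (poweR _ _); apply: eq_integral => x _; rewrite cnorm_sqr.
have w0 x : 0 <= w x by rewrite mulr_ge0 ?powR_ge0 ?sqmod_ge0.
have mw : measurable_fun setT w.
  apply: measurable_funM; last exact: (measurable_sqmod (cL2_meas hF)).
  apply: (measurableT_comp (measurable_powR s)).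
  by apply: measurable_funD => //; exact: exprn_measurable.
move=> hle.
have hw : L1 w.
  apply: L1_nonneg => //; rewrite ltey; apply/negP => /eqP e.
  by move: hle; rewrite e poweRyr.
split => //; move: hle; rewrite -intRE // poweR_EFin lee_fin powR12_sqrt; last exact: intR_ge0.
move=> hle; rewrite -[leLHS]sqr_sqrtr; last exact: intR_ge0.
by rewrite ler_pXn2r // nnegrE ?sqrtr_ge0 // ltW.
Qed.

(** The parameter r balances the two error terms, because r ^ s = E / d. *)
Lemma rate_identities (s E d : R) (p : nat) : 0 < s -> 0 < E -> 0 < d ->
  let r := (E / d) `^ (1 / s) in
  r ^+ p * d = E `^ (p%:R / s) * d `^ (1 - p%:R / s) /\
  r `^ (p%:R - s) * E = E `^ (p%:R / s) * d `^ (1 - p%:R / s).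
Proof.
move=> s0 E0 d0 r.
have ed : 0 <= E / d by rewrite divr_ge0 // ltW.
have s_neq0 : s != 0 by exact: lt0r_neq0.
have dinv (t : R) : (E / d) `^ t = E `^ t * d `^ (- t).
  by rewrite powRM ?invr_ge0 ?ltW // -powR_inv1 ?ltW // -powRrM mulN1r.
have e1 : r ^+ p * d = E `^ (p%:R / s) * d `^ (1 - p%:R / s).
  rewrite /r -powR_mulrn ?powR_ge0 // -powRrM.
  have -> : 1 / s * p%:R = p%:R / s by rewrite mul1r mulrC.
  rewrite dinv -mulrA; congr (_ * _).
  rewrite -{2}(powRr1 (ltW d0)) -powRD; first by rewrite addrC.
  by rewrite (gt_eqF d0) implybT.
split => //; rewrite -e1.
rewrite /r -powR_mulrn ?powR_ge0 // -!powRrM !dinv.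
have a1 : 1 / s * (p%:R - s) = p%:R / s - 1 by field.
rewrite a1 mul1r (mulrC s^-1).
have powD (a x y : R) : 0 < a -> a `^ (x + y) = a `^ x * a `^ y.
  by move=> a0; rewrite powRD // (gt_eqF a0) implybT.
rewrite opprB (addrC 1) !powD // !powRr1 ?ltW // (powR_inv1 (ltW E0)).
by field; exact: lt0r_neq0.
Qed.

(** On the Fourier side the difference is (sigma1 - sigma2) F f + sigma2 (F f - F g);
the first term is controlled by the integrable weight b1, the second by the uniform
bound b2 and the isometry. *)
Lemma fourier_multB_le sigma1 sigma2 (f g : R -> R[i]) (b1 : R -> R) (B1 b2 : R) :
  cmeasurable sigma1 -> cmeasurable sigma2 -> cL2 f -> cL2 g ->
  0 <= b2 ->
  L1 b1 -> intR b1 <= B1 ->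
  (forall x, sqmod ((sigma1 x - sigma2 x) * fourier f x) <= b1 x) ->
  (forall x, sqmod (sigma2 x) <= b2) ->
  cL2 (fourier_mult sigma1 f \- fourier_mult sigma2 g) /\
  sqnorm (fourier_mult sigma1 f \- fourier_mult sigma2 g) <= 2 * (B1 + b2 * sqnorm (f \- g)).
Proof.
move=> m1 m2 hf hg b20 hb1 IB1 hd hs2.
have hF := fourier_cL2 hf; have hG := fourier_cL2 hg.
have mult2 h : cL2 h -> cL2 (fun x => sigma2 x * h x).
  move=> hh; apply: (cL2_le (cmeasurableM m2 (cL2_meas hh)) (L1Z b2 (L1_sqmod hh))).
  by move=> x; rewrite sqmodM ler_wpM2r ?sqmod_ge0.
have mB : cmeasurable (fun x => sigma1 x - sigma2 x).
  case: m1 => m1 m1'; case: m2 => m2 m2'; split.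
    have -> : (fun x => complex.Re (sigma1 x - sigma2 x)) =
      (fun x => complex.Re (sigma1 x) - complex.Re (sigma2 x)).
      by apply/funext => x; case: (sigma1 x) => ? ?; case: (sigma2 x).
    exact: measurable_funB.
  have -> : (fun x => complex.Im (sigma1 x - sigma2 x)) =
    (fun x => complex.Im (sigma1 x) - complex.Im (sigma2 x)).
    by apply/funext => x; case: (sigma1 x) => ? ?; case: (sigma2 x).
  exact: measurable_funB.
have hdF : cL2 (fun x => (sigma1 x - sigma2 x) * fourier f x).
  exact: (cL2_le (cmeasurableM mB (cL2_meas hF)) hb1).
have h1 : cL2 (fun x => sigma1 x * fourier f x).
  have -> : (fun x => sigma1 x * fourier f x) =
    (fun x => (sigma1 x - sigma2 x) * fourier f x) \+ (fun x => sigma2 x * fourier f x).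
    by apply/funext => x /=; rewrite -mulrDl subrK.
  by apply: cL2D => //; exact: mult2.
have h2 := mult2 _ hG.
have [k1 e1] := fourier_multP h1; have [k2 e2] := fourier_multP h2.
split; first exact: cL2B.
rewrite -sqnorm_fourierB //.
have hFB := cL2B hF hG.
have hdFB := mult2 _ hFB.
set A := fun x => sigma1 x * fourier f x in h1 e1.
set B := fun x => sigma2 x * fourier g x in h2 e2.
have -> : sqnorm (fourier (fourier_mult sigma1 f) \- fourier (fourier_mult sigma2 g)) = sqnorm (A \- B).
  have mAB := measurable_sqmod (cL2_meas (cL2B h1 h2)).
  have [] // := L1_ae_eq (L1_sqmod (cL2B (fourier_cL2 k1) (fourier_cL2 k2))) mAB _.
  by apply: aeS (aeI e1 e2) => x [/= -> ->].
apply: (@le_trans _ _ (2 * (intR b1 + b2 * sqnorm (fourier f \- fourier g)))); last first.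
  by rewrite sqnorm_fourierB // ler_pM2l // lerD2r.
rewrite /sqnorm -(intRZ b2 (L1_sqmod hFB)) -(intRD hb1 (L1Z b2 (L1_sqmod hFB))).
rewrite -(intRZ 2 (L1D hb1 (L1Z b2 (L1_sqmod hFB)))).
apply: le_intR; [exact: (L1_sqmod (cL2B h1 h2))|exact: (L1Z 2 (L1D hb1 (L1Z b2 (L1_sqmod hFB))))|].
move=> x; have -> : (A \- B) x = (sigma1 x - sigma2 x) * fourier f x +
    sigma2 x * (fourier f x - fourier g x) by rewrite /A /B /=; ring.
apply: le_trans (sqmodD_le _ _) _; rewrite ler_pM2l // lerD //.
by rewrite sqmodM ler_wpM2r ?sqmod_ge0.
Qed.

End multipliers.

Theorem theorem1 (R : realType) (s : R) (p : nat) (C1 C2 : R) :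
  0 < s -> p%:R < s -> 0 < C1 -> 0 < C2 ->
  exists C : R, 0 < C /\
    forall m : R -> R -> R[i], admissible_filters s p C1 C2 m ->
    forall (E : R) (f : R -> R[i]) (delta : R) (fdelta : R -> R[i]),
      0 < E -> Hsfun s f -> (Hsnorm s f <= E%:E)%E ->
      0 < delta -> Lpfun 2 fdelta ->
      (Lpnorm 2 (f \- fdelta)%R < delta%:E)%E ->
      (Lpnorm 2 (derivL2 p f \-
                  regdiff p m ((E / delta) `^ (1 / s)) fdelta)%R
        <= (C * E `^ (p%:R / s) * delta `^ (1 - p%:R / s))%:E)%E.
Proof.
move=> s0 ps c1 c2; exists (2 * (C1 + C2)); split; first by rewrite mulr_gt0 // addr_gt0.
move=> m hm E f d fd E0 [/Lpfun2P hf _] hs d0 /Lpfun2P hfd hd.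
set r := (E / d) `^ (1 / s).
have r0 : 0 < r by rewrite powR_gt0 // divr_gt0.
have [mm hb] := hm r r0.
have [hw Iw] := Hs_weight E0 hf hs.
have [q1 q2] := rate_identities p s0 E0 d0.
set Q := E `^ (p%:R / s) * d `^ (1 - p%:R / s) in q1 q2.
have bnd x := monomial_bounds s0 ps r0 c1 c2 (hb x).1 (hb x).2.
have Nd : sqnorm (f \- fd) <= d ^+ 2.
  move: hd; rewrite Lpnorm2_sqnorm; last exact: cL2B.
  rewrite lte_fin => /ltW hd; rewrite -[leLHS]sqr_sqrtr ?sqnorm_ge0 //.
  by rewrite ler_pXn2r // nnegrE ?sqrtr_ge0 // ltW.
have ms1 := cmeasurable_monomial (R := R) p.
have ms2 := cmeasurableM ms1 mm.
pose a := (C2 * r `^ (p%:R - s)) ^+ 2.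
have hN := @fourier_multB_le R _ _ f fd
   (fun x => a * ((1 + x ^+ 2) `^ s * sqmod (fourier f x)))
   (a * E ^+ 2) _ ms1 ms2 hf hfd (sqr_ge0 (C1 * r ^+ p)) (L1Z a hw) _ _ (fun x => (bnd x).1).
have {hN} [] : cL2 (derivL2 p f \- regdiff p m r fd) /\
  sqnorm (derivL2 p f \- regdiff p m r fd) <=
    2 * (a * E ^+ 2 + (C1 * r ^+ p) ^+ 2 * sqnorm (f \- fd)).
  apply: hN.
    by rewrite intRZ // ler_wpM2l // sqr_ge0.
  move=> x; rewrite mulrA sqmodM ler_wpM2r ?sqmod_ge0 //.
  by rewrite -{1}(mulr1 ((0 +i* x) ^+ p)) -mulrBr; exact: (bnd x).2.
move=> k hN.
rewrite Lpnorm2_sqnorm // lee_fin -mulrA -/Q.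
have Q0 : 0 <= Q by rewrite mulr_ge0 ?powR_ge0.
rewrite -(@ger0_norm _ (2 * (C1 + C2) * Q)); last first.
  by rewrite mulr_ge0 // mulr_ge0 // addr_ge0 // ltW.
rewrite -sqrtr_sqr; apply: ler_wsqrtr; apply: le_trans hN _.
have -> : a * E ^+ 2 = (C2 * Q) ^+ 2 by rewrite -q2 /a; ring.
have : (C1 * r ^+ p) ^+ 2 * sqnorm (f \- fd) <= (C1 * Q) ^+ 2.
  rewrite -q1 -/r [in leRHS]mulrA [in leRHS]exprMn.
  by rewrite ler_wpM2l // sqr_ge0.
move=> h; have Q2 := sqr_ge0 Q.
have c12 : 0 <= C1 * C2 * Q ^+ 2 by rewrite mulr_ge0 // mulr_ge0 // ltW.
have := mulr_ge0 (sqr_ge0 C1) Q2; have := mulr_ge0 (sqr_ge0 C2) Q2.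
lra.
Qed.
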